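(* Let $\alpha>0$ be a constant and let $p=\frac{\alpha}{d}$. Let $Q^d_p$ be the random subgraph of the $d$-dimensional hypercube $Q^d$ obtained by retaining each edge independently with probability $p$, and let $\ell(Q^d_p)$ be the length of a longest increasing path in $Q^d_p$. \begin{enumerate} \item[(a)] For every constant $\alpha<e$ there exists $\delta=\delta(\alpha)$ with $0\le\delta<1$ such that with high probability $\ell(Q^d_p)\le \delta d$. \item[(b)] For every constant $\alpha>e$, with high probability $\ell(Q^d_p)\ge d-2$. Furthermore, \[ \mathbb{P}\big(\ell(Q^d_p)=d\big)=(1+o_d(1))\zeta_\alpha^2,\qquad \mathbb{P}\big(\ell(Q^d_p)=d-1\big)=(1+o_d(1))\,2\zeta_\alpha(1-\zeta_\alpha). \] \end{enumerate}
   Context: $Q^d$ is the graph on $\{0,1\}^d$ in which two vertices are adjacent iff they differ in exactly one coordinate. For $v\in\{0,1\}^d$, $I(v)\subseteq[d]$ is the set of coordinates of $v$ equal to $1$. A path $P=(v_1,\dots,v_k)$ in $Q^d$ is an increasing path of length $k-1$ if $|I(v_{i+1})|-|I(v_i)|=1$ for every $i\in[k-1]$ (so each step switches a $0$ coordinate to a $1$); for a subgraph $H\subseteq Q^d$, $\ell(H)$ is the length of a longest increasing path in $H$. For $\alpha>1$, $\zeta_\alpha$ is the unique solution in $(0,1)$ of $\zeta_\alpha=1-\exp(-\alpha\zeta_\alpha)$. ''With high probability'' means with probability tending to $1$ as $d\to\infty$, and $o_d(1)$ denotes a quantity tending to $0$ as $d\to\infty$. *)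

(* Defs.v *)
From mathcomp Require Import all_boot all_order all_algebra.
From mathcomp Require Import all_classical all_reals all_analysis.
From mathcomp Require Import ring lra.

Set Implicit Arguments.
Unset Strict Implicit.
Unset Printing Implicit Defensive.

Import Order.TTheory GRing.Theory Num.Theory.
Import numFieldNormedType.Exports.

Local Open Scope ring_scope.

Definition cube (d : nat) : finType := {ffun 'I_d -> bool}.

Definition ones (d : nat) (v : cube d) : {set 'I_d} := [set i | v i].

Definition cube_adj (d : nat) : rel (cube d) :=
  fun u v => #|[set i | u i != v i]| == 1%N.

(* An edge is the unordered pair of its two endpoints. *)
Definition cube_edges (d : nat) : {set {set cube d}} :=
  [set [set uv.1; uv.2] | uv : cube d * cube d & cube_adj uv.1 uv.2].

(* A subgraph of Q^d is represented by its set of edges H. *)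
Definition is_increasing_path (d : nat) (H : {set {set cube d}})
    (v : cube d) (s : seq (cube d)) : bool :=
  [&& uniq (v :: s),
      path (fun x y => [set x; y] \in H) v s &
      path (fun x y => #|ones y| == (#|ones x| + 1)%N) v s].

Definition has_increasing_path (d : nat) (H : {set {set cube d}}) (k : nat)
    : bool :=
  [exists v : cube d, exists s : k.-tuple (cube d), is_increasing_path H v s].

(* The bound k < #|cube d| excludes nothing, since the k + 1 vertices of a path
   of length k are distinct. *)
Definition ell (d : nat) (H : {set {set cube d}}) : nat :=
  (\max_(k < #|cube d| | has_increasing_path H k) k)%N.

(* The probability that Q^d_p satisfies A. This is a probability only for
   0 <= p <= 1; with p = alpha / d this holds as soon as d >= alpha. *)
Definition Pr_cube (R : realType) (d : nat) (p : R)
    (A : pred {set {set cube d}}) : R :=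
  \sum_(H in powerset (cube_edges d) | A H)
    p ^+ #|H| * (1 - p) ^+ #|cube_edges d :\: H|.

Local Open Scope classical_set_scope.

Definition is_zeta (R : realType) (alpha z : R) : Prop :=
  0 < z < 1 /\ z = 1 - expR (- (alpha * z)).

(* The default value 0 is irrelevant for alpha > 1, see [zetaP]. *)
Definition zeta (R : realType) (alpha : R) : R :=
  xget 0 [set z | is_zeta alpha z].

Lemma is_zeta_uniq (R : realType) (alpha y z : R) :
  is_zeta alpha y -> is_zeta alpha z -> y = z.
Proof.
wlog yz : y z / y < z.
  by move=> W hy hz; case: (ltgtP y z) => // h; [exact: W|apply/esym/W].
move=> [/andP[y0 y1] ey] [/andP[z0 z1] ez].
have Ey : expR (- (alpha * y)) = 1 - y by lra.
have Ez : expR (- (alpha * z)) = 1 - z by lra.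
have a_neq0 : alpha != 0.
  by apply/eqP => a0; move: Ey; rewrite a0 mul0r oppr0 expR0; lra.
have tangent a : a != - (alpha * y) ->
    (1 - y) * (1 + (a + alpha * y)) < expR a.
  move=> ane.
  have -> : expR a = (1 - y) * expR (a + alpha * y).
    by rewrite -Ey -expRD; congr expR; ring.
  rewrite ltr_pM2l; last by lra.
  by apply: expR_gt1Dx; rewrite addr_eq0.
have t0 := tangent 0; have tz := tangent (- (alpha * z)).
rewrite expR0 in t0; rewrite Ez in tz.
have {}t0 : (1 - y) * (1 + (0 + alpha * y)) < 1.
  by apply: t0; rewrite eq_sym oppr_eq0 mulf_neq0 // gt_eqF.
have {}tz : (1 - y) * (1 + (- (alpha * z) + alpha * y)) < 1 - z.
  apply: tz; rewrite eqr_opp; apply/eqP => /(mulfI a_neq0) h; lra.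
have h1 : (z - y) * ((1 - y) * (1 + (0 + alpha * y))) < (z - y) * 1.
  by rewrite ltr_pM2l // subr_gt0.
have h2 : y * ((1 - y) * (1 + (- (alpha * z) + alpha * y))) < y * (1 - z).
  by rewrite ltr_pM2l.
have := ltrD h1 h2.
have -> : (z - y) * ((1 - y) * (1 + (0 + alpha * y))) +
    y * ((1 - y) * (1 + (- (alpha * z) + alpha * y))) = z * (1 - y) by ring.
have -> : (z - y) * 1 + y * (1 - z) = z * (1 - y) by ring.
by rewrite ltxx.
Qed.

Lemma is_zeta_exists (R : realType) (alpha : R) :
  1 < alpha -> exists z, is_zeta alpha z.
Proof.
move=> a1; pose f (z : R) := 1 - expR (- (alpha * z)) - z.
pose c := (alpha - 1) / (2 * alpha).
have Ec : alpha * c = (alpha - 1) / 2 by rewrite /c; field; lra.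
have c0 : 0 < c by rewrite divr_gt0 //; lra.
have c1 : c < 1 by rewrite ltr_pdivrMr; lra.
have fc : 0 < f c.
  have h1 := expR_ge1Dx (alpha * c).
  have h2 : expR (alpha * c) * expR (- (alpha * c)) = 1.
    by rewrite -expRD subrr expR0.
  rewrite /f; set E := expR (- _) in h2 *.
  have E0 : 0 < E by exact: expR_gt0.
  have h3 : (1 + alpha * c) * E <= 1 by rewrite -[leRHS]h2 ler_pM2r.
  suff : (1 + alpha * c) * E < (1 + alpha * c) * (1 - c).
    by rewrite ltr_pM2l; lra.
  by apply: le_lt_trans h3 _; nra.
have f1 : f 1 < 0.
  by rewrite /f; have := expR_gt0 (- (alpha * 1)); lra.
have fcont : {within `[c, 1], continuous f}.
  apply: continuous_subspaceT => x; apply: cvgB; last exact: cvg_id.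
  apply: cvgB; first exact: cvg_cst.
  apply: (@continuous_comp _ _ _ (fun z => - (alpha * z)) expR); last first.
    exact: continuous_expR.
  by apply: cvgN; apply: cvgM; [exact: cvg_cst|exact: cvg_id].
have [|z zc fz0] := @IVT R f c 1 0 (ltW c1) fcont.
  by rewrite ge_min (ltW f1) orbT /= le_max (ltW fc).
exists z; move: zc; rewrite in_itv /= => /andP[cz z1].
split; last by move: fz0; rewrite /f; lra.
rewrite (lt_le_trans c0 cz) /= lt_neqAle z1 andbT.
by apply/eqP => zE; move: f1; rewrite -zE fz0 ltxx.
Qed.

Lemma zetaP (R : realType) (alpha : R) : 1 < alpha ->
  is_zeta alpha (zeta alpha) /\ forall z, is_zeta alpha z -> z = zeta alpha.
Proof.
move=> /is_zeta_exists[z hz].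
have h : is_zeta alpha (zeta alpha) by apply: (xgetI 0 (P := [set z | is_zeta alpha z]) hz).
by split=> // y hy; exact: is_zeta_uniq hy h.
Qed.

(* Main.v *)
(* Part (a) is a first-moment bound. A pair S subset b with |b| = |S| + k is joined by k!
   increasing paths, and for a suitable x > 0 the number of such pairs is at most
   (1+x)^(2d) x^-(d-k); since (alpha/d)^k k! is at most e d (alpha/e)^k, the expected number
   of increasing paths of length k = (1 - 1/N) d decays exponentially when alpha < e.

   For part (b), the set of vertices reached from the empty set after h steps behaves like a
   Poisson(alpha) branching process. By Harris' inequality the probability of reaching level h
   is at most the h-th iterate of r -> 1 - exp(-alpha r) started from 1, up to O(1/d), and
   these iterates tend to zeta. Conversely, an exploration that recurses into disjoint
   subcubes bounds the Laplace transform E s^Z of the number Z of vertices reached at level h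
   by 1 minus the same iterate started from 1 - s, and taking s close to 1 shows that Z >= K
   with probability at least zeta - o(1). Starting from many vertices of level 1 instead, the
   same event has probability 1 - o(1). The top of the cube is handled by complementation.
   Finally, given K vertices at level h and K vertices at level d - h, a second-moment
   computation with alpha > e shows that some pair is joined by an increasing path with
   probability at least 1 / (1 + C/K + C/(d-2h)). The three parts of the cube use disjoint
   edges, so the probabilities that l(Q^d_p) is at least d, d - 1 and d - 2 tend to zeta^2,
   1 - (1 - zeta)^2 and 1. *)

Require Import Defs.
From mathcomp Require Import all_boot all_order all_algebra.
From mathcomp Require Import all_classical all_reals all_analysis.
From mathcomp Require Import ring lra zify.
(* Imported last, so that set0, setIC, subsetP etc. denote the finite-set versions. *)
From mathcomp Require Import fintype finset.

Set Implicit Arguments.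
Unset Strict Implicit.
Unset Printing Implicit Defensive.

Import Order.TTheory GRing.Theory Num.Theory.
Import numFieldNormedType.Exports.

Local Open Scope ring_scope.

(** * Random subsets of a finite type *)

Section Bernoulli.
Variables (R : realType) (T : finType) (p : R).
Implicit Types (H E F : {set T}) (f g : {set T} -> R).

(** Independence and conditioning are both expressed by resampling in one product measure: an
    expectation is a nested expectation over the edges inside and outside a fixed set. The
    neighbours of a vertex do not survive independently, because paths through them can merge higher
    up. Non-survival is monotone, which gives one direction whatever the merging; for the other
    direction merging is prevented by force, at a cost O(1/d) since only a bounded number of levels
    is explored. The number e is the base in n! ~ (n/e)^n. In the second moment a shared edge gains
    a factor y = (1-p)/p, about d/alpha, while k shared edges shrink n! by at least about (n/e)^k,
    so sharing contributes a geometric series of ratio about e/alpha. A single pair of endpoints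
    would not give probability near 1: two paths with the same ends may share edges near these ends,
    which inflates the second moment by a constant factor. With K pairs having distinct ends, this
    affects only the diagonal, a fraction 1/K of the terms. *)

Definition bern_wt H : R := \prod_t (if t \in H then p else 1 - p).

Definition Ex f : R := \sum_(H : {set T}) bern_wt H * f H.

Definition mix E H1 H2 : {set T} := (H1 :&: E) :|: (H2 :\: E).

Definition depends_on E f := forall H, f H = f (H :&: E).

Lemma in_mix E H1 H2 t :
  (t \in mix E H1 H2) = if t \in E then t \in H1 else t \in H2.
Proof. by rewrite !inE; case: (t \in E); rewrite ?andbT ?andbF ?orbF. Qed.

Lemma eq_Ex f g : f =1 g -> Ex f = Ex g.
Proof. by move=> fg; apply: eq_bigr => H _; rewrite fg. Qed.

Lemma sum_bern_wt : \sum_(H : {set T}) bern_wt H = 1.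
Proof.
rewrite -[RHS](@big1 R 1 *%R T (index_enum T) xpredT (fun=> p + (1 - p))).
  by rewrite bigA_distr.
by move=> t _; rewrite addrC subrK.
Qed.

Lemma Ex_cst c : Ex (fun=> c) = c.
Proof. by rewrite /Ex -mulr_suml sum_bern_wt mul1r. Qed.

Lemma ExD f g : Ex (fun H => f H + g H) = Ex f + Ex g.
Proof. by rewrite /Ex -big_split; apply: eq_bigr => H _; rewrite mulrDr. Qed.

Lemma ExZ c f : Ex (fun H => c * f H) = c * Ex f.
Proof. by rewrite /Ex mulr_sumr; apply: eq_bigr => H _; rewrite mulrCA. Qed.

Lemma ExB f g : Ex (fun H => f H - g H) = Ex f - Ex g.
Proof.
rewrite -[in RHS]mulN1r -ExZ -ExD; apply: eq_Ex => H.
by rewrite mulN1r.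
Qed.

Lemma Ex_sum (I : Type) (r : seq I) (P : pred I) (F : I -> {set T} -> R) :
  Ex (fun H => \sum_(i <- r | P i) F i H) = \sum_(i <- r | P i) Ex (F i).
Proof.
rewrite /Ex exchange_big; apply: eq_bigr => H _.
by rewrite mulr_sumr.
Qed.

(* Resampling outside E preserves the measure: (H1, H2) |-> (mix E H1 H2, mix E H2 H1) is a
   weight-preserving involution. *)
Lemma Ex_mix E f : Ex f = Ex (fun H1 => Ex (fun H2 => f (mix E H1 H2))).
Proof.
pose sw (h : {set T} * {set T}) := (mix E h.1 h.2, mix E h.2 h.1).
have swK : involutive sw.
  move=> [H1 H2]; rewrite /sw /=; congr pair; apply/setP => t;
    by rewrite !in_mix; case: (t \in E).
transitivity (\sum_(h : {set T} * {set T}) bern_wt h.1 * bern_wt h.2 * f h.1).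
  rewrite -(pair_bigA _ (fun H H' => bern_wt H * bern_wt H' * f H)) /=.
  apply: eq_bigr => H _; rewrite -mulr_suml -mulr_sumr.
  by rewrite sum_bern_wt mulr1.
rewrite (reindex_inj (inv_inj swK)) /=.
rewrite -(pair_bigA _ (fun H1 H2 => bern_wt (mix E H1 H2) *
  bern_wt (mix E H2 H1) * f (mix E H1 H2))) /=.
apply: eq_bigr => H1 _; rewrite mulr_sumr; apply: eq_bigr => H2 _.
rewrite mulrA; congr (_ * _); rewrite /bern_wt -!big_split /=.
apply: eq_bigr => t _; rewrite !in_mix.
by case: (t \in E) => //; rewrite mulrC.
Qed.

Lemma depends_on_mixl E f H1 H2 : depends_on E f -> f (mix E H1 H2) = f H1.
Proof.
move=> fE; rewrite [LHS]fE [RHS]fE; congr f; apply/setP => t.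
by rewrite in_setI in_mix !inE; case: (t \in E); rewrite ?andbF.
Qed.

Lemma depends_on_mixr E E' f H1 H2 : [disjoint E & E'] ->
  depends_on E' f -> f (mix E H1 H2) = f H2.
Proof.
move=> dis fE; rewrite [LHS]fE [RHS]fE; congr f; apply/setP => t.
rewrite in_setI in_mix inE; case: ifP => // tE.
by rewrite (disjointFr dis tE) !andbF.
Qed.

Lemma depends_on_sub E E' f : E \subset E' -> depends_on E f -> depends_on E' f.
Proof.
by move=> sub fE H; rewrite fE [RHS]fE -setIA (setIidPr sub).
Qed.

(** After resampling outside E, f sees only the first sample and g only the second. *)
Lemma Ex_indep E f g : depends_on E f -> depends_on (~: E) g ->
  Ex (fun H => f H * g H) = Ex f * Ex g.
Proof.
move=> fE gE; rewrite (Ex_mix E) mulrC -ExZ; apply: eq_Ex => H1.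
rewrite mulrC -ExZ; apply: eq_Ex => H2.
by rewrite (depends_on_mixl _ _ fE) (depends_on_mixr _ _ _ gE) // -setI_eq0 setICr.
Qed.

Lemma depends_on_prod (I : eqType) E (r : seq I) (F : I -> {set T} -> R) :
  {in r, forall i, depends_on E (F i)} ->
  depends_on E (fun H => \prod_(i <- r) F i H).
Proof. by move=> h H; apply: eq_big_seq => i ir; rewrite h. Qed.

Lemma Ex_prod (I : eqType) (r : seq I) (F : I -> {set T} -> R) (E : I -> {set T}) :
  uniq r -> {in r, forall i, depends_on (E i) (F i)} ->
  {in r &, forall i j, i != j -> [disjoint E i & E j]} ->
  Ex (fun H => \prod_(i <- r) F i H) = \prod_(i <- r) Ex (F i).
Proof.
elim: r => [|i r IH] /=.
  by move=> _ _ _; rewrite big_nil -[RHS](Ex_cst 1); apply: eq_Ex => H; rewrite big_nil.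
move=> /andP[ir ur] dF dE; rewrite big_cons -IH //; last 2 first.
- by move=> j jr; apply: dF; rewrite inE jr orbT.
- by move=> j k jr kr; apply: dE; rewrite inE ?jr ?kr orbT.
rewrite -(@Ex_indep (E i)).
- by apply: eq_Ex => H; rewrite big_cons.
- by apply: dF; rewrite inE eqxx.
- apply: depends_on_prod => j jr.
  have jr' : j \in i :: r by rewrite inE jr orbT.
  apply: (depends_on_sub _ (dF j jr')).
  rewrite -disjoints_subset disjoint_sym dE ?inE ?eqxx //.
  by apply: contraNneq ir => ->.
Qed.

Lemma Ex_subset F : Ex (fun H => (F \subset H)%:R) = p ^+ #|F|.
Proof.
(* Distributing the product picks p for t in H and the second summand otherwise, so a set H that
   misses some t in F contributes 0. *)
transitivity (\prod_t (p + (if t \in F then 0 else 1 - p))).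
  rewrite bigA_distr; apply: eq_bigr => H _.
  have [FH|] := boolP (F \subset H).
    rewrite mulr1; apply: eq_bigr => t _; case: ifPn => // tH.
    by rewrite ifN //; apply: contra tH; apply: (subsetP FH).
  case/subsetPn => t tF tH; rewrite mulr0; apply/esym/eqP.
  by rewrite prodf_seq_eq0; apply/hasP; exists t; rewrite ?mem_index_enum // (negbTE tH) tF /=.
rewrite (bigID (mem F)) /= [X in _ * X]big1 ?mulr1; last first.
  by move=> t /negbTE ->; rewrite addrC subrK.
rewrite (eq_bigr (fun=> p)) ?prodr_const // => t ->.
by rewrite addr0.
Qed.

Hypothesis p01 : 0 <= p <= 1.

Lemma bern_wt_ge0 H : 0 <= bern_wt H.
Proof. by case/andP: p01 => p0 p1; apply: prodr_ge0 => t _; case: ifP => _; lra. Qed.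

Lemma le_Ex f g : (forall H, f H <= g H) -> Ex f <= Ex g.
Proof. by move=> fg; apply: ler_sum => H _; rewrite ler_wpM2l // bern_wt_ge0. Qed.

Lemma Ex_ge0 f : (forall H, 0 <= f H) -> 0 <= Ex f.
Proof. by move=> f0; rewrite -(Ex_cst 0); exact: le_Ex. Qed.

Definition antitone f := forall H H', H \subset H' -> f H' <= f H.

(** Induction on the support. Conditioning on one coordinate e leaves p f1 g1 + (1-p) f0 g0, which
    exceeds the product of the means by p (1-p) (f0 - f1) (g0 - g1); both differences are
    nonnegative because f and g decrease. *)
Lemma harris_support n E f g : #|E| = n ->
  depends_on E f -> depends_on E g -> antitone f -> antitone g ->
  Ex f * Ex g <= Ex (fun H => f H * g H).
Proof.
case/andP: (p01) => p0 p1; elim: n E f g => [|n IH] E f g.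
  move/eqP; rewrite cards_eq0 => /eqP -> fE gE _ _.
  have -> : Ex f = f set0 by rewrite -[RHS](Ex_cst _); apply: eq_Ex => H; rewrite fE setI0.
  have -> : Ex g = g set0 by rewrite -[RHS](Ex_cst _); apply: eq_Ex => H; rewrite gE setI0.
  rewrite -[leLHS](Ex_cst _); apply: le_Ex => H.
  by rewrite (fE H) (gE H) setI0.
move=> En fE gE fa ga.
have /card_gt0P[e eE] : (0 < #|E|)%N by rewrite En.
have E1n : #|E :\ e| = n by move: (cardsD1 e E); rewrite eE En => -[].
(* Only the coordinate e is resampled; the indicator of e in the second sample chooses between
   adding and deleting e. *)
have split1 h : Ex h = p * Ex (fun H => h (e |: H)) + (1 - p) * Ex (fun H => h (H :\ e)).
  rewrite (Ex_mix (~: [set e])) -!ExZ -ExD; apply: eq_Ex => H.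
  transitivity (Ex (fun H2 => h (H :\ e) + ([set e] \subset H2)%:R * (h (e |: H) - h (H :\ e)))).
    apply: eq_Ex => H2; rewrite sub1set; case: (boolP (e \in H2)) => eH2;
      rewrite ?mul1r ?mul0r ?addr0 ?subrKC //.
      congr h; apply/setP => t; rewrite in_mix !inE.
      by case: eqP => [->|].
    congr h; apply/setP => t; rewrite in_mix !inE.
    by case: eqP => [->|//] /=; rewrite (negbTE eH2).
  rewrite ExD Ex_cst; under eq_Ex do rewrite mulrC.
  by rewrite ExZ Ex_subset cards1 expr1; ring.
have dep1 h : depends_on E h -> depends_on (E :\ e) (fun H => h (e |: H)).
  move=> hE H /=; rewrite hE [RHS]hE; congr h; apply/setP => t.
  by rewrite !inE; case: eqP => //= _; case: (t \in E); rewrite ?andbF ?andbT.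
have dep0 h : depends_on E h -> depends_on (E :\ e) (fun H => h (H :\ e)).
  move=> hE H /=; rewrite hE [RHS]hE; congr h; apply/setP => t.
  by rewrite !inE; case: eqP => //= _; case: (t \in E); rewrite ?andbF ?andbT.
have an1 h : antitone h -> antitone (fun H => h (e |: H)).
  by move=> ha H H' HH; apply: ha; apply: setUS.
have an0 h : antitone h -> antitone (fun H => h (H :\ e)).
  by move=> ha H H' HH; apply: ha; apply: setSD.
have le10 h : antitone h -> Ex (fun H => h (e |: H)) <= Ex (fun H => h (H :\ e)).
  by move=> ha; apply: le_Ex => H; apply: ha; rewrite (subset_trans (subsetDl _ _)) ?subsetUr.
rewrite (split1 f) (split1 g) (split1 (fun H => _ * _)).
have := IH _ _ _ E1n (dep1 _ fE) (dep1 _ gE) (an1 _ fa) (an1 _ ga).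
have := IH _ _ _ E1n (dep0 _ fE) (dep0 _ gE) (an0 _ fa) (an0 _ ga).
move: (le10 _ fa) (le10 _ ga).
set f1 := Ex (fun H => f (e |: H)); set f0 := Ex (fun H => f (H :\ e)).
set g1 := Ex (fun H => g (e |: H)); set g0 := Ex (fun H => g (H :\ e)).
set fg0 := Ex _; set fg1 := Ex _ => lef leg h0 h1.
have h1' : p * (f1 * g1) <= p * fg1 by rewrite ler_wpM2l //; lra.
have h0' : (1 - p) * (f0 * g0) <= (1 - p) * fg0 by rewrite ler_wpM2l //; lra.
have h2 : 0 <= (p * (1 - p)) * ((f0 - f1) * (g0 - g1)).
  by rewrite !mulr_ge0 //; lra.
apply: le_trans (lerD h1' h0'); rewrite -subr_ge0.
suff -> : p * (f1 * g1) + (1 - p) * (f0 * g0) - (p * f1 + (1 - p) * f0) * (p * g1 + (1 - p) * g0)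
  = (p * (1 - p)) * ((f0 - f1) * (g0 - g1)) by [].
by ring.
Qed.

Lemma harris f g : antitone f -> antitone g ->
  Ex f * Ex g <= Ex (fun H => f H * g H).
Proof. by apply: (@harris_support #|T| [set: T]); rewrite ?cardsT // => H; rewrite setIT. Qed.

Lemma harris_prod (I : Type) (r : seq I) (F : I -> {set T} -> R) :
  (forall i, antitone (F i)) -> (forall i H, 0 <= F i H) ->
  \prod_(i <- r) Ex (F i) <= Ex (fun H => \prod_(i <- r) F i H).
Proof.
move=> Fa F0; elim: r => [|i r IH].
  rewrite big_nil -[leLHS]Ex_cst; apply: le_Ex => H.
  by rewrite big_nil lexx.
rewrite big_cons; under [leRHS]eq_Ex do rewrite big_cons.
have Pa : antitone (fun H => \prod_(j <- r) F j H).
  elim: r {IH} => [H H' _|j r IH H H' HH]; first by rewrite !big_nil.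
  rewrite !big_cons; apply: ler_pM => //; [exact: prodr_ge0|exact: Fa|exact: IH].
apply: le_trans (harris (Fa i) Pa).
by rewrite ler_wpM2l // Ex_ge0.
Qed.

(** Cauchy-Schwarz for f and the indicator of f > 0: average the pointwise bound 2 t f <= t^2 f^2 +
    [f > 0] and take t = m / v. If v = 0, a large t forces m = 0. *)
Lemma second_moment f : (forall H, 0 <= f H) ->
  Ex f ^+ 2 <= Ex (fun H => (0 < f H)%R%:R) * Ex (fun H => f H ^+ 2).
Proof.
move=> f0; set q := Ex (fun H => (0 < f H)%R%:R); set m := Ex f; set v := Ex _.
have q0 : 0 <= q by apply: Ex_ge0 => H; rewrite ler0n.
have key t : 2 * t * m <= t ^+ 2 * v + q.
  rewrite /m /v /q -!ExZ -ExD; apply: le_Ex => H.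
  have := f0 H; rewrite le_eqVlt => /orP[/eqP <-|fH].
    by rewrite mulr0 expr0n mulr0 ltxx.
  by rewrite fH mulr1n; have := sqr_ge0 (t * f H - 1); nra.
have v0 : 0 <= v by apply: Ex_ge0 => H; exact: sqr_ge0.
have m0 : 0 <= m by exact: Ex_ge0.
move: v0; rewrite le_eqVlt => /orP[/eqP v0|v0].
  rewrite -v0 mulr0; suff -> : m = 0 by rewrite expr0n.
  apply/eqP; rewrite eq_le m0 andbT leNgt; apply/negP => mp.
  have := key ((q + 1) / m); rewrite -v0 mulr0 add0r.
  have -> : 2 * ((q + 1) / m) * m = 2 * (q + 1) by field; lra.
  by lra.
have := key (m / v).
have -> : 2 * (m / v) * m = 2 * (m ^+ 2 / v) by field; lra.
have -> : (m / v) ^+ 2 * v = m ^+ 2 / v by field; lra.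
move=> h; have : m ^+ 2 / v <= q by lra.
by rewrite ler_pdivrMr.
Qed.

End Bernoulli.

(** * Renewal estimates for the second moment *)

Section Factorials.
Variable R : realType.
Implicit Types (n m k : nat) (y : R).
Local Notation e := (expR 1 : R).

Lemma succ_exp_le n j : (j <= n)%N -> n.+1%:R ^+ j <= e * n%:R ^+ j.
Proof.
case: n => [|n]; first by rewrite leqn0 => /eqP ->; rewrite !expr0 mulr1 -expR0 ler_expR.
move=> jn; have n0 : (0 : R) < n.+1%:R by rewrite ltr0n.
have -> : n.+2%:R = n.+1%:R * (1 + n.+1%:R^-1) :> R.
  by rewrite mulrDr mulr1 mulfV ?gt_eqF // -natr1.
rewrite exprMn mulrC ler_pM2r ?exprn_gt0 //.
apply: (@le_trans _ _ (expR n.+1%:R^-1 ^+ j)).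
  by rewrite lerXn2r ?nnegrE ?expR_ge0 ?expR_ge1Dx // addr_ge0 // invr_ge0 ltW.
rewrite -expRM_natl ler_expR ler_pdivrMr // mul1r ler_nat //.
Qed.

(** The falling factorial n! / (n-k)! is at least (n/e)^k, which is how e enters the second moment.
    Induction with n - k fixed; each step costs (1 + 1/n)^k <= e. *)
Lemma fact_falling_lb n k : (k <= n)%N ->
  n%:R ^+ k * (n - k)`!%:R <= e ^+ k * n`!%:R.
Proof.
move=> kn; have [m ->] : exists m, (n = m + k)%N by exists (n - k)%N; rewrite subnK.
rewrite addnK; elim: k {n kn} => [|k IH]; first by rewrite addn0 !expr0.
rewrite addnS factS natrM.
have -> : e ^+ k.+1 * ((m + k).+1%:R * (m + k)`!%:R) =
  (m + k).+1%:R * e * (e ^+ k * (m + k)`!%:R) by rewrite exprS; ring.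
apply: le_trans (_ : (m + k).+1%:R * e * ((m + k)%:R ^+ k * m`!%:R) <= _); last first.
  by rewrite ler_wpM2l // mulr_ge0 ?ler0n ?expR_ge0.
rewrite exprS -!mulrA ler_wpM2l ?ler0n // mulrA ler_wpM2r ?ler0n //.
by rewrite succ_exp_le // leq_addl.
Qed.

(** A weak Stirling bound, k! <= e k (k/e)^k, used in the first moment. The induction step is (1 +
    1/k)^(k+1) >= e. *)
Lemma fact_ub k : (0 < k)%N -> e ^+ k * k`!%:R <= e * k%:R * k%:R ^+ k.
Proof.
case: k => // k _; elim: k => [|k IH]; first by rewrite !expr1 !mulr1.
have k0 : (0 : R) < k.+1%:R by rewrite ltr0n.
have k0' : (0 : R) < k.+2%:R by rewrite ltr0n.
have step : e * k.+1%:R ^+ k.+2 <= k.+2%:R ^+ k.+2.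
  have h : k.+1%:R / k.+2%:R <= expR (- k.+2%:R^-1) :> R.
    apply: le_trans (expR_ge1Dx _).
    by rewrite -[k.+2%:R]natr1 in k0' *; rewrite le_eqVlt; apply/orP; left; apply/eqP; field; lra.
  have : (k.+1%:R / k.+2%:R) ^+ k.+2 <= expR (- k.+2%:R^-1) ^+ k.+2 :> R.
    by rewrite lerXn2r ?nnegrE ?expR_ge0 ?divr_ge0.
  rewrite -expRM_natl mulrN mulfV ?gt_eqF // expRN expr_div_n.
  rewrite ler_pdivrMr ?exprn_gt0 // mulrC ler_pdivlMr ?expR_gt0 //.
  by rewrite mulrC.
rewrite exprS factS natrM.
have -> : e * e ^+ k.+1 * (k.+2%:R * k.+1`!%:R) = e * k.+2%:R * (e ^+ k.+1 * k.+1`!%:R) by ring.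
apply: (@le_trans _ _ (e * k.+2%:R * (e * k.+1%:R * k.+1%:R ^+ k.+1))).
  by rewrite ler_wpM2l // mulr_ge0 ?expR_ge0.
rewrite -[_ * _ * k.+1%:R ^+ _]mulrA -exprS.
by rewrite ler_wpM2l // mulr_ge0 ?expR_ge0.
Qed.

Lemma fact_mul_le t s : (1 < t)%N -> (1 < s)%N ->
  (t`! * s`! <= 2 * (t + s - 2)`!)%N.
Proof.
case: t => [//|[//|t]] _ s1; have -> : (t.+2 + s - 2 = t + s)%N by lia.
elim: t => [|t IH]; first by rewrite add0n.
rewrite [t.+3`!]factS addSn [(t + s).+1`!]factS -mulnA.
by apply: leq_trans (leq_mul (leqnn t.+3) IH) _; nia.
Qed.

(** The two end terms are (n-1)! each, and the n - 3 interior terms are at most 2 (n-2)! each by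
    [fact_mul_le]. *)
Lemma sum_fact_mul_le n : (\sum_(1 <= t < n) t`! * (n - t)`! <= 4 * n.-1`!)%N.
Proof.
case: n => [|[|[|n]]]; [by rewrite big_geq|by rewrite big_geq|by rewrite big_nat1|].
rewrite big_ltn // big_nat_recr //=.
rewrite subSS subn0 (_ : (n.+3 - n.+2 = 1)%N); last by lia.
rewrite (_ : 1`! = 1%N) // mul1n muln1.
have : (\sum_(2 <= t < n.+2) t`! * (n.+3 - t)`! <= \sum_(2 <= t < n.+2) 2 * n.+1`!)%N.
  rewrite big_nat [X in (_ <= X)%N]big_nat; apply: leq_sum => t /andP[t2 tn].
  apply: leq_trans (fact_mul_le _ _) _; [lia|lia|].
  by rewrite (_ : (t + (n.+3 - t) - 2 = n.+1)%N) //; lia.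
rewrite sum_nat_const_nat [n.+2`!]factS; nia.
Qed.

End Factorials.

Section Renewal.
Variable R : realType.
Local Notation e := (expR 1 : R).

(** The self-convolution of the factorial is at least 2 m! for m >= 1, because both end terms equal
    m!. Keeping D 0 = 1 but making D m a large constant times m! turns the end term j = m into a
    small fraction of D m, so that essentially only j = 0 counts. *)
Lemma renewal_majorant (eta : R) : 0 < eta ->
  exists D : nat -> R, exists2 C, 0 < C &
  [/\ D 0%N = 1, forall m, 0 <= D m, forall m, m`!%:R <= (1 + eta) * D m,
      forall m, D m <= C * m`!%:R &
      forall m, \sum_(j < m.+1) j`!%:R * D (m - j)%N <= (1 + eta) * D m].
Proof.
move=> eta0.
have [M0 M0P] : exists M0 : nat, 8 / eta <= M0%:R.
  exists (Num.bound (8 / eta)); apply: ltW.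
  by have := archi_boundP (divr_ge0 (ler0n R 8) (ltW eta0)).
(* The 5 pays 4 for the interior of the convolution and 1 for its term j = m. The 8 behind M0 pays
   for the interior once more, out of half of the slack eta. *)
pose A : R := 5 / eta + 1.
have A1 : 1 <= A by rewrite /A lerDr divr_ge0 // ltW.
have eA : 5 <= eta * A by rewrite /A mulrDr mulrC divfK ?gt_eqF // mulr1 lerDl ltW.
have eM : 8 <= eta * M0%:R by rewrite mulrC -ler_pdivrMr.
have M0gt : (0 < M0)%N.
  by rewrite lt0n; apply/eqP => M00; move: eM; rewrite M00 mulr0; lra.
(* The factor A absorbs the convolution while m <= M0; beyond M0 the convolution of
   factorials is dominated by its end terms, so the factor may stay constant. *)
pose D m : R := A ^+ minn m M0 * m`!%:R.
have A0 : 0 < A by lra.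
have AX n : 0 < A ^+ n by rewrite exprn_gt0.
have D0 m : 0 <= D m by rewrite mulr_ge0 // ltW.
have Dfact m : m`!%:R <= D m.
  by rewrite ler_peMl // exprn_ege1.
exists D; exists (A ^+ M0) => //; split => //.
- by rewrite /D min0n mulr1.
- by move=> m; apply: le_trans (Dfact m) _; rewrite mulrDl mul1r lerDl mulr_ge0 // ltW.
- by move=> m; rewrite ler_wpM2r // ler_weXn2l // geq_minr.
move=> m; rewrite big_ord_recl mulrDl mul1r /= subn0 !mul1r; apply: lerD => //.
case: m => [|m]; first by rewrite big_ord0 mulr_ge0 // ltW.
rewrite big_ord_recr /= /bump /= add1n subnn.
have -> : D 0%N = 1 by rewrite /D min0n mulr1.
rewrite mulr1.
have bound a : (forall j, (1 <= j <= m)%N -> A ^+ minn (m.+1 - j) M0 <= A ^+ a) ->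
  \sum_(i < m) (1 + i)`!%:R * D (m.+1 - (1 + i))%N <= A ^+ a * (4 * m`!%:R).
  move=> h; have := sum_fact_mul_le m.+1; rewrite big_add1 /= big_mkord => h4.
  apply: le_trans (_ : A ^+ a * (\sum_(i < m) (i.+1)`! * (m.+1 - i.+1)`!)%:R <= _); last first.
    by rewrite ler_wpM2l ?(ltW (AX _)) // -natrM ler_nat.
  rewrite natr_sum mulr_sumr; apply: ler_sum => i _.
  rewrite add1n natrM /D mulrCA; apply: ler_wpM2r; first by rewrite mulr_ge0.
  by apply: h; rewrite /= ltn_ord.
have mf : m.+1`!%:R = m.+1%:R * m`!%:R :> R by rewrite factS natrM.
have m1 : (1 : R) <= m.+1%:R by rewrite ler1n.
have f0 : (0 : R) < m`!%:R by rewrite ltr0n fact_gt0.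
have [mM|Mm] := leqP m.+1 M0.
  apply: le_trans (lerD (bound m _) (lexx _)) _.
    by move=> j /andP[j1 jm]; rewrite ler_weXn2l // (leq_trans (geq_minl _ _)) //; lia.
  rewrite /D (minn_idPl mM) exprS mf.
  have AXm : 1 <= A ^+ m by rewrite exprn_ege1.
  have -> : eta * (A * A ^+ m * (m.+1%:R * m`!%:R)) = (eta * A) * (A ^+ m * (m.+1%:R *
    m`!%:R)) by ring.
  apply: (@le_trans _ _ (5 * (A ^+ m * (m.+1%:R * m`!%:R)))); last first.
    by rewrite ler_wpM2r // !mulr_ge0 // ltW.
  have h1 : A ^+ m * m`!%:R <= A ^+ m * (m.+1%:R * m`!%:R).
    by rewrite ler_wpM2l ?(ltW (AX _)) // ler_peMl // ltW.
  have h2 : m.+1%:R * m`!%:R <= A ^+ m * (m.+1%:R * m`!%:R).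
    by rewrite ler_peMl // mulr_ge0 // ltW.
  by lra.
apply: le_trans (lerD (bound M0 _) (lexx _)) _.
  by move=> j _; rewrite ler_weXn2l // geq_minr.
rewrite /D (minn_idPr (ltnW Mm)) mf.
have AM : A <= A ^+ M0 by rewrite -[leLHS]expr1 ler_weXn2l.
have h1 : 8 <= eta * m.+1%:R.
  by apply: le_trans eM _; rewrite ler_wpM2l ?(ltW eta0) // ler_nat ltnW.
have h2 : 5 <= eta * A ^+ M0 by apply: le_trans eA _; rewrite ler_wpM2l // ltW.
have -> : eta * (A ^+ M0 * (m.+1%:R * m`!%:R)) =
  ((eta * m.+1%:R) * (A ^+ M0 * m`!%:R)) / 2 + ((eta * A ^+ M0) * (m.+1%:R * m`!%:R)) / 2 by
    field.
have h3 : 8 * (A ^+ M0 * m`!%:R) <= (eta * m.+1%:R) * (A ^+ M0 * m`!%:R).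
  by rewrite ler_wpM2r // mulr_ge0 // ltW.
have h4 : 5 * (m.+1%:R * m`!%:R) <= (eta * A ^+ M0) * (m.+1%:R * m`!%:R).
  by rewrite ler_wpM2r // mulr_ge0 // ltW.
have h5 : 0 < m.+1%:R * m`!%:R :> R by rewrite mulr_gt0 // ltr0n.
by lra.
Qed.

End Renewal.

Section Discounted.
Variable R : realType.
Local Notation e := (expR 1 : R).

(** In generating functions, D(z) / (1 - y z). *)
Fixpoint discounted (y : R) (D : nat -> R) (m : nat) : R :=
  if m is k.+1 then D k.+1 + y * discounted y D k else D 0%N.

Lemma discountedE y D m : discounted y D m = \sum_(k < m.+1) y ^+ k * D (m - k)%N.
Proof.
elim: m => [|m IH] /=; first by rewrite big_ord1 mul1r.
rewrite big_ord_recl mul1r subn0; congr (_ + _).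
by rewrite IH mulr_sumr; apply: eq_bigr => i _; rewrite mulrA -exprS.
Qed.

Lemma discounted_ge y D (u : nat -> R) : 0 <= y -> u 0%N <= D 0%N ->
  (forall m, u m.+1 <= D m.+1 + y * u m) -> forall m, u m <= discounted y D m.
Proof.
move=> y0 u0 uS; elim=> [//|m IH] /=.
by apply: le_trans (uS m) _; rewrite lerD2l ler_wpM2l.
Qed.

(** Multiplication by 1 / (1 - y z) commutes with the convolution and has nonnegative coefficients,
    so the inequality for D is inherited. *)
Lemma fact_conv_discounted eta y D : 0 <= y ->
  (forall m, \sum_(j < m.+1) j`!%:R * D (m - j)%N <= (1 + eta) * D m) ->
  forall m, \sum_(j < m.+1) j`!%:R * discounted y D (m - j)%N
            <= (1 + eta) * discounted y D m.
Proof.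
move=> y0 DP; elim=> [|m IH].
  by apply: le_trans (DP 0%N); rewrite !big_ord1.
rewrite big_ord_recr subnn [discounted _ _ m.+1]/= mulrDr.
rewrite [(1 + eta) * (y * _)]mulrCA.
apply: le_trans _ (lerD (DP m.+1) (ler_wpM2l y0 IH)).
rewrite [in leRHS]big_ord_recr subnn /= addrAC lerD2r.
rewrite mulr_sumr -big_split /= le_eqVlt; apply/orP; left; apply/eqP.
apply: eq_bigr => i _; rewrite subSn /= -1?ltnS //.
by ring.
Qed.

(** The bound is a supersolution of the recurrence: convolving it with the factorials costs a factor
    1 + eta, which is absorbed by the enlarged rate (1 + eta) y. *)
Lemma renewal_le eta y (D f g : nat -> R) n : 0 <= eta -> 0 <= y ->
  (forall m, \sum_(j < m.+1) j`!%:R * D (m - j)%N <= (1 + eta) * D m) ->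
  (forall m, f m <= (1 + eta) * D m) ->
  (forall m, (m <= n)%N -> g m <= f m + y * \sum_(j < m) j`!%:R * g (m.-1 - j)%N) ->
  forall m, (m <= n)%N -> g m <= (1 + eta) * discounted ((1 + eta) * y) D m.
Proof.
move=> eta0 y0 DP fD gP; have Y0 : 0 <= (1 + eta) * y by rewrite mulr_ge0 // addr_ge0.
elim/ltn_ind=> m IH mn; apply: le_trans (gP m mn) _.
case: m IH mn => [|m] IH mn; first by rewrite big_ord0 mulr0 addr0; exact: fD.
rewrite /= mulrDr; apply: lerD; first exact: fD.
have h : \sum_(j < m.+1) j`!%:R * g (m - j)%N <= (1 + eta) *
    \sum_(j < m.+1) j`!%:R * discounted ((1 + eta) * y) D (m - j)%N.
  rewrite mulr_sumr; apply: ler_sum => j _; rewrite mulrCA ler_wpM2l //.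
  by apply: IH; lia.
apply: le_trans (ler_wpM2l y0 h) _.
have := fact_conv_discounted Y0 DP m; move=> h2.
rewrite [leRHS]mulrCA [leLHS]mulrA [y * (1 + eta)]mulrC.
exact: ler_wpM2l.
Qed.

Lemma sum_expr_le (rho : R) m : 0 <= rho < 1 ->
  \sum_(k < m) rho ^+ k <= (1 - rho)^-1.
Proof.
move=> /andP[r0 r1]; have d0 : 0 < 1 - rho by lra.
rewrite -[leRHS]mul1r ler_pdivlMr // mulrC.
have -> : (1 - rho) * \sum_(k < m) rho ^+ k = 1 - rho ^+ m.
  by rewrite -opprB mulNr -subrX1 opprB.
by rewrite gerBl exprn_ge0.
Qed.

Lemma sum_succ_expr_le (rho : R) m : 0 <= rho < 1 ->
  \sum_(k < m) k.+1%:R * rho ^+ k <= (1 - rho)^-1 ^+ 2.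
Proof.
move=> /andP[r0 r1]; have d0 : 0 < 1 - rho by lra.
rewrite exprVn -[leRHS]mul1r ler_pdivlMr ?exprn_gt0 //.
have -> : (\sum_(k < m) k.+1%:R * rho ^+ k) * (1 - rho) ^+ 2 =
    1 - rho ^+ m - m%:R * rho ^+ m * (1 - rho).
  elim: m => [|m IH]; first by rewrite big_ord0 expr0; ring.
  by rewrite big_ord_recr /= mulrDl IH !exprS -!natr1; ring.
have h1 : 0 <= rho ^+ m by rewrite exprn_ge0.
have h2 : 0 <= m%:R * rho ^+ m * (1 - rho) by rewrite !mulr_ge0 // ltW.
by lra.
Qed.

Lemma expr_fact_le (rho y : R) n k : 0 <= y -> y * e <= rho * n%:R -> (k <= n)%N ->
  y ^+ k * (n - k)`!%:R <= rho ^+ k * n`!%:R.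
Proof.
move=> y0 yr kn; have := fact_falling_lb R kn => h.
have e0 : 0 < e ^+ k by rewrite exprn_gt0 // expR_gt0.
rewrite -(ler_pM2r e0) mulrAC -exprMn.
have r0 : 0 <= rho * n%:R by apply: le_trans yr; rewrite mulr_ge0 // expR_ge0.
apply: (@le_trans _ _ ((rho * n%:R) ^+ k * (n - k)`!%:R)).
  by rewrite ler_wpM2r // lerXn2r ?nnegrE // mulr_ge0 // expR_ge0.
have [n0|n0] := posnP n.
  by move: kn; rewrite n0 leqn0 => /eqP ->; rewrite !expr0 subnn !mulr1.
have rr : 0 <= rho by move: r0; rewrite pmulr_lge0 // ltr0n.
rewrite exprMn -!mulrA ler_wpM2l ?exprn_ge0 // mulrC.
by rewrite [n`!%:R * _]mulrC mulrC.
Qed.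

(* g n is the weighted number of paths meeting a given path from a to b of length n, where
   each shared edge carries an extra factor y = 1/p - 1. The sum runs over the position of
   the first shared edge counted. *)
Lemma diag_bound (eta rho : R) : 0 < eta -> 0 <= rho < 1 ->
  exists2 C, 0 < C & forall n y (g : nat -> R), 0 <= y ->
    (1 + eta) * y * e <= rho * n%:R ->
    (forall m, (m <= n)%N -> g m <= m`!%:R + y * \sum_(j < m) j`!%:R * g (m.-1 - j)%N) ->
    g n <= C * n`!%:R.
Proof.
move=> eta0 rho01; have [D [C C0 [D0 Dge0 fD DC convD]]] := renewal_majorant eta0.
have r1 : 0 < (1 - rho)^-1 by rewrite invr_gt0; lra.
exists ((1 + eta) * (C * (1 - rho)^-1)); first by rewrite !mulr_gt0 //; lra.
move=> n y g y0 yn gP.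
apply: le_trans (renewal_le (ltW eta0) y0 convD fD gP (leqnn n)) _.
rewrite -!mulrA; apply: ler_wpM2l; first by lra.
rewrite mulrA discountedE.
have Y0 : 0 <= (1 + eta) * y by rewrite mulr_ge0 //; lra.
apply: (@le_trans _ _ (\sum_(k < n.+1) C * n`!%:R * rho ^+ k)).
  apply: ler_sum => k _.
  have kn : (k <= n)%N by rewrite -ltnS.
  have h := expr_fact_le Y0 yn kn.
  have h2 : C * (((1 + eta) * y) ^+ k * (n - k)`!%:R) <= C * (rho ^+ k * n`!%:R).
    by rewrite ler_wpM2l // ltW.
  have h3 : ((1 + eta) * y) ^+ k * D (n - k)%N <= ((1 + eta) * y) ^+ k * (C * (n - k)`!%:R).
    by rewrite ler_wpM2l // exprn_ge0.
  apply: le_trans h3 _; rewrite mulrCA; apply: le_trans h2 _.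
  by rewrite mulrAC mulrA.
rewrite -mulr_sumr [leRHS]mulrAC; apply: ler_wpM2l; last exact: sum_expr_le.
by rewrite mulr_ge0 // ltW.
Qed.

Lemma leq_succ_mul_sub n k : (k.+1 < n)%N -> (n <= k.+2 * (n - k.+1))%N.
Proof. by move=> kn; rewrite -{1}(subnK (ltnW kn)); nia. Qed.

(* Same as diag_bound for two paths with distinct starting points and distinct endpoints:
   neither the first nor the last edge can be shared, which gains a factor 1/n. *)
Lemma cross_bound (eta rho : R) : 0 < eta -> 0 <= rho < 1 ->
  exists2 C, 0 < C & forall n y (g : nat -> R), (0 < n)%N -> 0 <= y ->
    (1 + eta) * y * e <= rho * n%:R -> g 0%N <= 0 ->
    (forall m, (0 < m <= n)%N -> g m <= m`!%:R + y * \sum_(j < m) j`!%:R * g (m.-1 - j)%N) ->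
    n`!%:R + y * \sum_(1 <= t < n) t`!%:R * g (n.-1 - t)%N <= (1 + C / n%:R) * n`!%:R.
Proof.
move=> eta0 rho01; have [D [C C0 [D0 Dge0 fD DC convD]]] := renewal_majorant eta0.
have r1 : 0 < (1 - rho)^-1 by rewrite invr_gt0; lra.
(* Removing the value at 0 encodes distinct endpoints; distinct starting points are encoded by the
   sum over t >= 1 in the conclusion. *)
pose D' m := if m is 0%N then 0 else D m.
pose f' m : R := if m is 0%N then 0 else m`!%:R.
have D'D m : D' m <= D m by case: m => [|m] /=; rewrite ?D0.
have convD' m : \sum_(j < m.+1) j`!%:R * D' (m - j)%N <= (1 + eta) * D' m.
  case: m => [|m]; first by rewrite big_ord1 !mulr0.
  by apply: le_trans (convD m.+1); apply: ler_sum => j _; rewrite ler_wpM2l.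
have fD' m : f' m <= (1 + eta) * D' m by case: m => [|m]; rewrite ?mulr0 ?lexx /= ?fD.
exists (4 * C * (1 - rho)^-1 ^+ 2); first by apply: mulr_gt0; [apply: mulr_gt0|exact: exprn_gt0].
move=> n y g n0 y0 yn g0 gP.
have gP' m : (m <= n)%N -> g m <= f' m + y * \sum_(j < m) j`!%:R * g (m.-1 - j)%N.
  by case: m => [_|m mn]; [rewrite big_ord0 mulr0 addr0|exact: gP].
have gY := renewal_le (ltW eta0) y0 convD' fD' gP'.
set Y := (1 + eta) * y in gY yn.
have Y0 : 0 <= Y by rewrite mulr_ge0 //; lra.
(* With both end terms gone, d1 m is of order (m-1)! instead of m!; u is the same convolution with
   the discounted sequence. *)
pose u m := \sum_(1 <= t < m.+1) t`!%:R * discounted Y D' (m - t)%N.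
pose d1 m := \sum_(1 <= t < m) t`!%:R * D (m - t)%N.
have uS m : u m.+1 <= d1 m.+1 + Y * u m.
  rewrite /u big_nat_recr //= subnn /= mulr0 addr0.
  rewrite /d1 mulr_sumr -big_split /= 2!big_nat; apply: ler_sum => t /andP[t1 tm].
  rewrite subSn //= mulrDr; apply: lerD => //.
  by rewrite mulrCA lexx.
have u0 : u 0%N <= d1 0%N by rewrite /u /d1 !big_geq.
have d1le m : (0 < m)%N -> d1 m <= 4 * C * m.-1`!%:R.
  move=> m0; apply: (@le_trans _ _ (C * (4 * m.-1`!)%:R)); last by rewrite natrM; lra.
  apply: (@le_trans _ _ (C * (\sum_(1 <= t < m) t`! * (m - t)`!)%:R)); last first.
    by rewrite ler_wpM2l ?(ltW C0) // ler_nat sum_fact_mul_le.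
  rewrite natr_sum mulr_sumr; apply: ler_sum => t _.
  by rewrite natrM mulrCA ler_wpM2l.
have d10 : d1 0%N = 0 by rewrite /d1 big_geq.
have := discounted_ge Y0 u0 uS n.-1; rewrite discountedE prednK // => un.
rewrite mulrDl mul1r lerD2l.
apply: (@le_trans _ _ (Y * u n.-1)).
  rewrite /Y [_ * y]mulrC -mulrA; apply: ler_wpM2l => //.
  rewrite /u prednK // mulr_sumr 2!big_nat; apply: ler_sum => t /andP[t1 tn].
  rewrite mulrCA; apply: ler_wpM2l => //; apply: gY.
  by rewrite (leq_trans (leq_subr _ _)) // leq_pred.
apply: le_trans (ler_wpM2l Y0 un) _.
have nR : (0 : R) < n%:R by rewrite ltr0n.
apply: (@le_trans _ _ (\sum_(k < n) (4 * C * n`!%:R / n%:R) * (k.+2%:R * rho ^+ k.+1)));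
  last first.
  rewrite -mulr_sumr -mulrA.
  have -> : 4 * C * (1 - rho)^-1 ^+ 2 / n%:R * n`!%:R =
    4 * C * (n`!%:R / n%:R * (1 - rho)^-1 ^+ 2) by ring.
  rewrite -!mulrA; do 2 (apply: ler_wpM2l; first by lra).
  rewrite [leLHS]mulrA [leRHS]mulrA; apply: ler_wpM2l; first by rewrite divr_ge0.
  apply: le_trans (sum_succ_expr_le n.+1 rho01).
  by rewrite [leRHS]big_ord_recl lerDr mulr_ge0.
rewrite mulr_sumr; apply: ler_sum => k _; have kn := ltn_ord k.
have [km|] := ltnP k n.-1; last first.
  move=> km; have nk0 : (n.-1 - k = 0)%N by apply/eqP; rewrite subn_eq0.
  rewrite [X in d1 X]nk0 d10 !mulr0.
  by move/andP: rho01 => [? ?]; rewrite !(mulr_ge0, divr_ge0, exprn_ge0) // ltW.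
have d1k : d1 (n.-1 - k)%N <= 4 * C * (n.-1 - k).-1`!%:R by apply: d1le; rewrite subn_gt0.
have h := expr_fact_le Y0 yn (_ : (k.+1 <= n)%N).
have {}h := h kn.
have nk : (n - k.+1)%N = (n.-1 - k).-1.+1 by rewrite prednK ?subn_gt0 // -subn1 -subnDA add1n.
move: h; rewrite nk factS natrM -nk => h.
have nk0 : (0 : R) < (n - k.+1)%:R by rewrite ltr0n nk.
(* This trades the gain 1/(n-k-1) for (k+2)/n; the factor k + 2 is absorbed by the series in
   [sum_succ_expr_le]. *)
have kn2 : n%:R <= k.+2%:R * (n - k.+1)%:R :> R.
  by rewrite -natrM ler_nat leq_succ_mul_sub // -subn_gt0 nk.
have d1Y : Y * (Y ^+ k * d1 (n.-1 - k)%N) <= 4 * C * (Y ^+ k.+1 * (n.-1 - k).-1`!%:R).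
  rewrite mulrA -exprS mulrCA; apply: ler_wpM2l => //.
  exact: exprn_ge0.
apply: le_trans d1Y _; rewrite -!mulrA; do 2 (apply: ler_wpM2l; first by lra).
set F := _`!%:R in h *; set X := Y ^+ k.+1 in h *; set r := rho ^+ k.+1 in h *.
have XF : 0 <= X * F by rewrite mulr_ge0 // exprn_ge0.
have -> : n`!%:R * (n%:R^-1 * (k.+2%:R * r)) = k.+2%:R * (r * n`!%:R) / n%:R by field; lra.
rewrite ler_pdivlMr //.
apply: (@le_trans _ _ (k.+2%:R * (X * ((n - k.+1)%:R * F)))); last by rewrite ler_wpM2l.
have -> : k.+2%:R * (X * ((n - k.+1)%:R * F)) = X * F * (k.+2%:R * (n - k.+1)%:R) by ring.
exact: ler_wpM2l.
Qed.

End Discounted.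

(** * The hypercube as a set of directed edges *)

Section Transport.
Variables (R : realType) (T : finType) (p : R).
Implicit Types (H E G : {set T}).

Lemma Ex_setI_eq E G : G \subset E ->
  Ex p (fun H => (H :&: E == G)%:R) = p ^+ #|G| * (1 - p) ^+ #|E :\: G|.
Proof.
move=> GE.
transitivity (\prod_t ((if t \in E :\: G then 0 else p) + (if t \in G then 0 else 1 - p))).
  rewrite bigA_distr; apply: eq_bigr => H _.
  have [HEG|HEG] := eqVneq (H :&: E) G.
    rewrite mulr1; apply: eq_bigr => t _; move/setP/(_ t): HEG; rewrite !inE.
    by case: (t \in H) => /= <-; case: (t \in E).
  rewrite mulr0; apply/esym/eqP; rewrite prodf_seq_eq0; apply: contraNT HEG => /hasPn h.
  apply/eqP/setP => t; have := h t (mem_index_enum t) => /=.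
  rewrite !inE; have := fintype.subsetP GE t.
  by case: (t \in G) => [->|_] //=; case: (t \in H); case: (t \in E) => //=; rewrite eqxx.
rewrite (bigID (mem G)) /= (eq_bigr (fun=> p)); last first.
  by move=> t tG; rewrite inE tG addr0.
rewrite prodr_const; congr (_ * _).
rewrite (bigID (mem E)) /= [X in _ * X]big1 ?mulr1; last first.
  by move=> t /andP[/negbTE tG /negbTE tE]; rewrite inE tE andbF tG addrC subrK.
rewrite -[RHS]prodr_const; apply: eq_big => [t|t]; first by rewrite inE.
by move=> /andP[tG tE]; rewrite inE tE tG /= add0r (negbTE tG).
Qed.

Lemma Ex_powerset E (f : {set T} -> R) : depends_on E f ->
  Ex p f = \sum_(G in powerset E) p ^+ #|G| * (1 - p) ^+ #|E :\: G| * f G.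
Proof.
move=> fE; rewrite /Ex (partition_big (fun H => H :&: E) (mem (powerset E))) /=; last first.
  by move=> H _; rewrite inE subsetIr.
apply: eq_bigr => G; rewrite inE => GE.
rewrite -(Ex_setI_eq GE) /Ex mulr_suml big_mkcond; apply: eq_bigr => H _.
case: eqP => [HG|_]; last by rewrite mulr0 mul0r.
by rewrite mulr1 fE HG.
Qed.

Lemma Ex_involution (tau : T -> T) (f : {set T} -> R) : involutive tau ->
  Ex p (fun H => f (tau @^-1: H)) = Ex p f.
Proof.
move=> tauK; have sK : involutive (fun H : {set T} => tau @^-1: H).
  by move=> H; apply/setP => t; rewrite !inE tauK.
rewrite /Ex [RHS](reindex_inj (inv_inj sK)); apply: eq_bigr => H _; congr (_ * _).
rewrite /bern_wt [LHS](reindex_inj (inv_inj tauK)); apply: eq_bigr => t _.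
by rewrite inE.
Qed.

End Transport.

Section Cube.
Variable d : nat.
Local Notation V := {set 'I_d}.
Implicit Types (S : V) (x : 'I_d) (s : seq 'I_d) (H : {set V * 'I_d}).

Fixpoint upath H S s : bool :=
  if s is x :: s' then [&& x \notin S, (S, x) \in H & upath H (x |: S) s'] else true.

Definition endp S s : V := foldl (fun A x => x |: A) S s.

Definition vec S : cube d := [ffun i => i \in S].

(* The edge from S to x |: S is encoded as the pair (S, x). Pairs with x \in S are junk that
   no increasing path uses. *)
Definition up_edges : {set V * 'I_d} := [set e : V * 'I_d | e.2 \notin e.1].

Definition cube_edge (e : V * 'I_d) : {set cube d} := [set vec e.1; vec (e.2 |: e.1)].

Definition cube_graph H : {set {set cube d}} := cube_edge @: (H :&: up_edges).

Lemma ones_vec S : ones (vec S) = S.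
Proof. by apply/setP => i; rewrite inE ffunE. Qed.

Lemma vec_ones (v : cube d) : vec (ones v) = v.
Proof. by apply/ffunP => i; rewrite ffunE inE. Qed.

Lemma vec_inj : injective vec.
Proof. exact: can_inj ones_vec. Qed.

(** An edge determines its lower endpoint by size. The bound on [#|S'|] excludes that S' is the
    upper endpoint of the other edge, and injectivity may assume it by symmetry. *)
Lemma cube_edge_eq S S' x x' : x \notin S -> (#|S'| <= #|S|)%N ->
  cube_edge (S', x') = [set vec S; vec (x |: S)] -> (S', x') = (S, x).
Proof.
move=> xS SS' /setP eq2.
have := eq2 (vec S'); rewrite !inE eqxx /= => /esym; rewrite !(inj_eq vec_inj).
case/orP => /eqP SE; last first.
  by move: SS'; rewrite SE cardsU1 xS add1n ltnn.
rewrite SE in eq2 *; congr pair.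
have := eq2 (vec (x |: S)); rewrite !inE eqxx orbT /= !(inj_eq vec_inj).
case/orP => /eqP.
  by move/setP/(_ x); rewrite !inE eqxx (negbTE xS).
by move/setP/(_ x); rewrite !inE eqxx (negbTE xS) !orbF => /esym/eqP ->.
Qed.

Lemma cube_edge_inj : {in up_edges &, injective cube_edge}.
Proof.
move=> [S x] [S' x']; rewrite !inE /= => xS xS' ee.
have [SS|SS] := leqP #|S'| #|S|.
  by symmetry; apply: (@cube_edge_eq S S' x x') => //; rewrite -ee.
by apply: (@cube_edge_eq S' S x' x) => //; exact: ltnW.
Qed.

Lemma cube_edgesE : cube_edges d = cube_edge @: up_edges.
Proof.
apply/setP => A; apply/imsetP/imsetP => -[[u v]]; rewrite !inE /=.
  move=> /cards1P[i iP] ->.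
  have uv j : (u j != v j) = (j == i) by have := in_set1 j i; rewrite -iP inE.
  have ui : u i != v i by rewrite uv.
  have half (w w' : cube d) : (forall j, (w j != w' j) = (j == i)) -> ~~ w i ->
      [set w; w'] = cube_edge (ones w, i).
    move=> ww wi; rewrite /cube_edge /= vec_ones; congr ([set _; _]).
    apply/ffunP => j; rewrite ffunE !inE; have := ww j.
    have [->|_] /= := eqVneq j i; first by rewrite (negbTE wi); case: (w' i).
    by case: (w j); case: (w' j).
  case: (boolP (u i)) => [ui1|ui0]; last first.
    by exists (ones u, i); [rewrite !inE|exact: half].
  exists (ones v, i); first by rewrite !inE /=; case: (v i) ui; rewrite ui1.
  rewrite setUC; apply: half; last by case: (v i) ui; rewrite ui1.
  by move=> j; rewrite eq_sym.
move=> uv ->; exists (vec u, vec (v |: u)) => //=.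
rewrite inE /cube_adj; apply/cards1P; exists v; apply/setP => j.
rewrite !inE !ffunE !inE; have [->|_] /= := eqVneq j v; first by rewrite (negbTE uv).
by case: (j \in u).
Qed.

(** Integrating out the pairs outside [up_edges] leaves a sum over G in [up_edges], and G ->
    [cube_edge @: G] is a bijection onto the subgraphs that preserves both cardinals in the
    weight. *)
Lemma Pr_cubeE (R : realType) (p : R) (A : pred {set {set cube d}}) :
  Pr_cube p A = Ex p (fun H => (A (cube_graph H))%:R).
Proof.
rewrite (@Ex_powerset _ _ _ up_edges); last first.
  by move=> H; rewrite /cube_graph -setIA setIid.
rewrite /Pr_cube cube_edgesE big_mkcondr /=.
rewrite (reindex_onto (fun G : {set V * 'I_d} => cube_edge @: G)
  (fun B => up_edges :&: cube_edge @^-1: B)) /=; last first.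
  move=> B; rewrite inE => BE; apply/setP => b; apply/imsetP/idP.
    by case=> e; rewrite !inE => /andP[_ eB] ->.
  move=> bB; have /imsetP[e eE be] := fintype.subsetP BE b bB.
  by exists e => //; rewrite !inE -be bB andbT; rewrite inE in eE.
apply: eq_big => [G|G].
  rewrite !inE; apply/andP/idP => [[_ /eqP <-]|GE]; first exact: subsetIl.
  split; first exact: imsetS.
  apply/eqP/setP => e; rewrite !inE; apply/andP/idP => [[eE /imsetP[e' e'G ee]]|eG].
    rewrite (cube_edge_inj _ _ ee) ?inE //.
    by have := fintype.subsetP GE _ e'G; rewrite inE.
  by split; [have := fintype.subsetP GE _ eG; rewrite inE|exact: imset_f].
rewrite !inE => /andP[_ /eqP GE'].
have GE : G \subset up_edges by rewrite -GE' subsetIl.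
have GI : {in G &, injective cube_edge}.
  by move=> e e' eG e'G; apply: cube_edge_inj; exact: (fintype.subsetP GE).
rewrite /cube_graph (setIidPl GE).
rewrite card_in_imset //.
have -> : cube_edge @: up_edges :\: cube_edge @: G = cube_edge @: (up_edges :\: G).
  apply/setP => b; rewrite inE; apply/andP/imsetP.
    move=> [bG /imsetP[e eE be]]; exists e => //; rewrite inE eE andbT.
    by apply: contra bG => eG; rewrite be imset_f.
  move=> [e]; rewrite inE => /andP[eG eE] ->; split; last exact: imset_f.
  apply: contra eG => /imsetP[e' e'G ee].
  by rewrite (cube_edge_inj _ _ ee) //; exact: (fintype.subsetP GE).
rewrite card_in_imset; last first.
  move=> e e' /setDP[eE _] /setDP[eE' _]; exact: cube_edge_inj.
by case: (A _); rewrite ?mulr1 ?mulr0.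
Qed.

End Cube.

(** * Increasing paths as sequences of directions, and complementation *)

Section Paths.
Variable d : nat.
Local Notation V := {set 'I_d}.
Implicit Types (S : V) (x : 'I_d) (s t : seq 'I_d) (H : {set V * 'I_d}).

Lemma endp_cat S s t : endp S (s ++ t) = endp (endp S s) t.
Proof. exact: foldl_cat. Qed.

Lemma sub_endp S s : S \subset endp S s.
Proof.
elim: s S => [//|x s IH] S /=.
by rewrite (subset_trans _ (IH _)) ?subsetUr.
Qed.

Lemma upath_cat H S s t : upath H S (s ++ t) = upath H S s && upath H (endp S s) t.
Proof. by elim: s S => [//|x s IH] S /=; rewrite IH !andbA. Qed.

Lemma card_endp H S s : upath H S s -> #|endp S s| = (#|S| + size s)%N.
Proof.
elim: s S => [|x s IH] S /=; first by rewrite addn0.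
by move=> /and3P[xS _ /IH ->]; rewrite cardsU1 xS add1n addSnnS.
Qed.

Lemma card_le_d S : (#|S| <= d)%N.
Proof. by rewrite -[leqRHS]card_ord max_card. Qed.

Lemma upath_size_le H S s : upath H S s -> (#|S| + size s <= d)%N.
Proof. by move=> /card_endp <-; exact: card_le_d. Qed.

Lemma upath_agree H H' S s :
  (forall (A : V) x, (#|S| <= #|A| < #|S| + size s)%N ->
    ((A, x) \in H) = ((A, x) \in H')) -> upath H S s = upath H' S s.
Proof.
elim: s S => [//|x s IH] S /= HH; have [xS|//] := boolP (x \notin S).
rewrite /= HH ?leqnn ?addnS ?ltnS ?leq_addr // IH // => A y.
rewrite cardsU1 xS add1n => Ay; apply: HH.
by move: Ay => /= /andP[? ?]; apply/andP; split; lia.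
Qed.

Fixpoint pverts S t : seq (cube d) :=
  if t is x :: t' then vec (x |: S) :: pverts (x |: S) t' else [::].

Lemma size_pverts S t : size (pverts S t) = size t.
Proof. by elim: t S => [//|x t IH] S /=; rewrite IH. Qed.

Lemma pverts_increasing H S t : upath H S t ->
  is_increasing_path (cube_graph H) (vec S) (pverts S t).
Proof.
move=> Ht.
have lev : path (fun u v : cube d => #|ones v| == (#|ones u| + 1)%N) (vec S) (pverts S t).
  elim: t S Ht => [//|x t IH] S /= /and3P[xS _ /IH ->].
  by rewrite !ones_vec cardsU1 xS addnC eqxx.
apply/and3P; split=> //; last first.
  elim: t S Ht {lev} => [//|x t IH] S /= /and3P[xS xH /IH ->].
  by rewrite andbT; apply/imsetP; exists (S, x) => //; rewrite !inE /= xH xS.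
(* Distinctness of the vertices follows from their strictly growing levels. *)
apply: (@sorted_uniq _ (fun u v : cube d => (#|ones u| < #|ones v|)%N)).
- by move=> u v w; exact: ltn_trans.
- by move=> u; rewrite ltnn.
- by apply: sub_path lev => u v /eqP ->; rewrite addn1.
Qed.

Lemma increasing_upath H v (s : seq (cube d)) :
  is_increasing_path (cube_graph H) v s ->
  exists2 t, size t = size s & upath H (ones v) t.
Proof.
move=> /and3P[_]; elim: s v => [|w s IH] v /=; first by exists [::].
move=> /andP[/imsetP[[S x]]]; rewrite !inE /= => /andP[SxH xS] vw ps /andP[/eqP cw /IH].
move=> /(_ ps)[t ts Ht]; exists (x :: t); first by rewrite /= ts.
suff [ev ew] : v = vec S /\ w = vec (x |: S).
  by rewrite /= ev ones_vec xS SxH -(ones_vec (x |: S)) -ew.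
have cx : #|x |: S| = #|S|.+1 by rewrite cardsU1 xS.
have /setP/(_ v) := vw; have /setP/(_ w) := vw.
rewrite !inE !eqxx orbT /= => /esym/orP[]/eqP ew /esym/orP[]/eqP ev //;
  by move: cw; rewrite ew ev !ones_vec ?cx; set n := #|_|; clear; lia.
Qed.

(** A longer path is cut to its first k steps; conversely k <= d < 2^d keeps k in the range of the
    maximum. *)
Lemma leq_ellP H k :
  reflect (exists S s, size s = k /\ upath H S s) (k <= ell (cube_graph H))%N.
Proof.
apply: (iffP idP) => [|[S [s [sk Hs]]]]; last first.
  have kd : (k < #|cube d|)%N.
    rewrite card_ffun card_bool card_ord.
    apply: leq_ltn_trans (_ : d < _)%N; last exact: ltn_expl.
    by have := upath_size_le Hs; rewrite sk; lia.
  apply: (@leq_bigmax_cond _ (fun i : 'I_#|cube d| => has_increasing_path _ i) _ (Ordinal kd)).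
  apply/existsP; exists (vec S); apply/existsP.
  have ps : size (pverts S s) == k by rewrite size_pverts sk.
  by exists (Tuple ps); exact: pverts_increasing.
case: k => [_|k]; first by exists set0, [::].
move=> kell; have : ~~ (ell (cube_graph H) <= k)%N by rewrite -ltnNge.
have [/existsP[i /andP[Pi ki]] _|no] := boolP [exists i : 'I_#|cube d|,
    has_increasing_path (cube_graph H) i && (k < i)%N]; last first.
  case/negP; apply/bigmax_leqP => i Pi; rewrite leqNgt; apply: contra no => ki.
  by apply/existsP; exists i; rewrite Pi.
move: Pi => /existsP[v /existsP[s /increasing_upath[t ts Ht]]].
exists (ones v), (take k.+1 t); split.
  by rewrite size_take ts size_tuple; case: ltnP => // ik; apply/eqP; rewrite eqn_leq ik ki.
by move: Ht; rewrite -{1}(cat_take_drop k.+1 t) upath_cat => /andP[].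
Qed.

Lemma ell_le_d H : (ell (cube_graph H) <= d)%N.
Proof.
by have /leq_ellP[S [s [<- /upath_size_le]]] := leqnn (ell (cube_graph H)); lia.
Qed.

(* Complementation of vertices reverses increasing paths; junk pairs are fixed so that
   dual_edge is an involution on the whole type. *)
Definition dual_edge (e : V * 'I_d) : V * 'I_d :=
  (if e.2 \in e.1 then e.1 else ~: (e.2 |: e.1), e.2).

Lemma dual_edgeK : involutive dual_edge.
Proof.
move=> [S x]; rewrite /dual_edge /=; have [xS|xS] := boolP (x \in S); first by rewrite xS.
rewrite !inE eqxx /=; congr pair; apply/setP => y; rewrite !inE.
by have [->|_] := eqVneq y x; rewrite ?(negbTE xS) //= negbK.
Qed.

Lemma upath_dual H S s : upath (dual_edge @^-1: H) S s ->
  upath H (~: endp S s) (rev s) /\ endp (~: endp S s) (rev s) = ~: S.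
Proof.
elim: s S => [//|x s IH] S /= /and3P[xS xH /IH[Hr er]].
rewrite rev_cons -cats1 upath_cat endp_cat er Hr /=.
move: xH; rewrite inE /dual_edge /= (negbTE xS) => ->.
rewrite !inE eqxx; split=> //; apply/setP => y; rewrite !inE.
by have [->|_] := eqVneq y x; rewrite ?(negbTE xS).
Qed.

End Paths.

(** * Counting paths and the second moment *)

Section PathSums.
Variables (R : realType) (d : nat).
Local Notation V := {set 'I_d}.
Implicit Types (S a b u : V) (x : 'I_d) (s t : seq 'I_d) (H : {set V * 'I_d}).
Implicit Types (w : V * 'I_d -> R) (n m : nat).

(** Weighted number of increasing paths of length n from S to b. Three weights occur: 1 counts all
    paths, membership in H counts the paths of H, and 1 + y [e shared] computes second moments. *)
Fixpoint psum w n S b : R :=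
  if n is n'.+1 then \sum_(x | x \notin S) w (S, x) * psum w n' (x |: S) b
  else (S == b)%:R.

Fixpoint upaths n S b : seq (seq 'I_d) :=
  if n is n'.+1 then
    flatten [seq [seq x :: s | s <- upaths n' (x |: S) b] | x <- enum (~: S)]
  else if S == b then [:: [::]] else [::].

Fixpoint pedges S s : seq (V * 'I_d) :=
  if s is x :: s' then (S, x) :: pedges (x |: S) s' else [::].

Lemma psumE w n S b :
  psum w n S b = \sum_(s <- upaths n S b) \prod_(e <- pedges S s) w e.
Proof.
elim: n S => [|n IH] S /=.
  by case: eqP => _; rewrite ?big_nil // big_seq1 big_nil.
rewrite big_flatten /= big_map big_enum /=; apply: eq_big => x.
  by rewrite inE.
move=> _; rewrite IH mulr_sumr big_map; apply: eq_bigr => s _.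
by rewrite /= big_cons.
Qed.

Lemma upathsP n S b s : s \in upaths n S b ->
  [/\ size s = n, upath [set: V * 'I_d] S s & endp S s = b].
Proof.
elim: n S s => [|n IH] S s /=.
  by case: eqP => [->|_] //; rewrite inE => /eqP ->.
move=> /flatten_mapP[x]; rewrite mem_enum inE => xS /mapP[t /IH[<- Ht et] ->] /=.
by rewrite xS in_setT Ht.
Qed.

Lemma psum_scale c w n S b :
  psum (fun e => c * w e) n S b = c ^+ n * psum w n S b.
Proof.
elim: n S => [|n IH] S /=; first by rewrite mul1r.
by rewrite mulr_sumr; apply: eq_bigr => x _; rewrite IH exprS; ring.
Qed.

Lemma psum_ge0 w n S b : (forall e, 0 <= w e) -> 0 <= psum w n S b.
Proof.
move=> w0; elim: n S => [|n IH] S /=; first exact: ler0n.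
by apply: sumr_ge0 => x _; rewrite mulr_ge0.
Qed.

(** The paths from S to b are the orderings of b \ S. *)
Lemma psum1E n S b :
  psum (fun=> 1) n S b = if (S \subset b) && (#|b| == #|S| + n)%N then n`!%:R else 0.
Proof.
elim: n S => [|n IH] S /=.
  rewrite addn0 eqEcard; case: (boolP (S \subset b)) => //= Sb.
  by rewrite eqn_leq (subset_leq_card Sb) andbT; case: (_ <= _)%N.
transitivity (\sum_(x in b :\: S | (S \subset b) && (#|b| == #|S| + n.+1)%N) n`!%:R : R).
  rewrite [RHS]big_mkcond [LHS]big_mkcond; apply: eq_bigr => x _ /=.
  rewrite inE; case: (boolP (x \in S)) => //= xS.
  rewrite IH mul1r subUset sub1set cardsU1 xS add1n addSnnS.
  by case: (x \in b).
case: ifP => [/andP[Sb /eqP cb]|_]; last by rewrite big_pred0 // => x; rewrite andbF.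
under eq_bigl do rewrite andbT.
by rewrite sumr_const cardsDS // cb addKn factS natrM mulr_natl.
Qed.

Lemma psumS w n S b :
  psum w n.+1 S b = \sum_(x | x \notin S) w (S, x) * psum w n (x |: S) b.
Proof. by []. Qed.

Lemma psum0 w S b : psum w 0 S b = (S == b)%:R.
Proof. by []. Qed.

Lemma psum1S n S b :
  psum (fun=> 1) n.+1 S b = \sum_(x | x \notin S) psum (fun=> 1) n (x |: S) b.
Proof. by apply: eq_bigr => x _; rewrite mul1r. Qed.

Arguments psum : simpl never.

Lemma psum1_le n S b : psum (fun=> 1) n S b <= n`!%:R.
Proof. by rewrite psum1E; case: ifP. Qed.

Lemma pedges_card S s e : upath [set: V * 'I_d] S s -> e \in pedges S s ->
  (#|S| <= #|e.1| < #|S| + size s)%N.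
Proof.
elim: s S => [//|x s IH] S /= /and3P[xS _ Hs]; rewrite inE => /orP[/eqP ->|es] /=.
  by rewrite leqnn addnS ltnS leq_addr.
by have /andP[] := IH _ Hs es; rewrite cardsU1 xS add1n => /ltnW -> /=; rewrite addSnnS.
Qed.

Lemma pedges_uniq S s : upath [set: V * 'I_d] S s -> uniq (pedges S s).
Proof.
elim: s S => [//|x s IH] S /= /and3P[xS _ Hs]; rewrite IH // andbT.
apply/negP => /(pedges_card Hs) /andP[]; rewrite cardsU1 xS add1n.
by rewrite ltnn.
Qed.

Lemma size_pedges S s : size (pedges S s) = size s.
Proof. by elim: s S => [//|x s IH] S /=; rewrite IH. Qed.

Lemma pedges_cat S s t : pedges S (s ++ t) = pedges S s ++ pedges (endp S s) t.
Proof. by elim: s S => [//|x s IH] S /=; rewrite IH. Qed.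

Lemma upathE H S s : upath H S s =
  upath [set: V * 'I_d] S s && all (fun e => e \in H) (pedges S s).
Proof.
elim: s S => [//|x s IH] S /=; rewrite IH in_setT /=.
by case: (x \notin S) => //=; rewrite andbCA.
Qed.

(** A path has exactly one edge on each level, so on a given level membership is equality with that
    edge. *)
Lemma mem_pedges a s (t : nat) : upath [set: V * 'I_d] a s -> (t < size s)%N ->
  exists x, [/\ x \notin endp a (take t s),
    endp a (take t.+1 s) = x |: endp a (take t s) &
    forall u (y : 'I_d), #|u| = (#|a| + t)%N ->
      ((u, y) \in pedges a s) = (u == endp a (take t s)) && (y == x)].
Proof.
move=> Hs ts; have x0 : 'I_d by case: s ts {Hs}.
have es : s = take t s ++ nth x0 s t :: drop t.+1 s by rewrite -drop_nth // cat_take_drop.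
have szt : size (take t s) = t by rewrite size_takel // ltnW.
move: Hs; rewrite {1}es upath_cat /= => /and4P[H1 xS _ H2].
exists (nth x0 s t); split=> //.
  by rewrite (take_nth x0 ts) -cats1 endp_cat.
move=> u y uc; rewrite {1}es pedges_cat mem_cat /= inE xpair_eqE.
have /negbTE -> : (u, y) \notin pedges a (take t s).
  by apply/negP => /(pedges_card H1) /=; rewrite uc szt ltnn andbF.
have /negbTE -> : (u, y) \notin pedges (nth x0 s t |: endp a (take t s)) (drop t.+1 s).
  apply/negP => /(pedges_card H2) /=; rewrite uc cardsU1 xS add1n (card_endp H1) szt.
  by rewrite ltnn.
by rewrite orbF.
Qed.

(* Expand the product of the factors 1 + y [e in path a s] along a second path according to
   the first edge at which the second summand is chosen. *)
Lemma psum_shared y a s b n : upath [set: V * 'I_d] a s -> size s = n ->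
  let w e := 1 + y * (e \in pedges a s)%:R in
  let v (t : nat) := endp a (take t s) in
  forall m u, (m <= n)%N -> #|u| = (#|a| + (n - m))%N ->
  psum w m u b = psum (fun=> 1) m u b +
    y * \sum_(j < m) psum (fun=> 1) j u (v (n - m + j)%N) *
                     psum w (m.-1 - j) (v (n - m + j).+1) b.
Proof.
move=> Hs sn w v; elim=> [|m IH] u mn uc; first by rewrite big_ord0 mulr0 addr0.
have [x [xv vS memE]] : exists x, [/\ x \notin v (n - m.+1)%N,
    v (n - m.+1).+1%N = x |: v (n - m.+1)%N & forall u (y : 'I_d), #|u| = (#|a| + (n - m.+1))%N ->
      ((u, y) \in pedges a s) = (u == v (n - m.+1)%N) && (y == x)].
  by apply: mem_pedges => //; rewrite sn; lia.
(* The first step has weight 1 unless it is the edge of s on this level; that edge supplies the term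
   j = 0, and induction the others. *)
transitivity (\sum_(z | z \notin u) psum w m (z |: u) b +
    y * ((u == v (n - m.+1)%N)%:R * psum w m (v (n - m.+1).+1%N) b)).
  rewrite psumS (eq_bigr (fun z => psum w m (z |: u) b +
      y * ((u == v (n - m.+1)%N) && (z == x))%:R * psum w m (z |: u) b)); last first.
    by move=> z _; rewrite /w memE // mulrDl mul1r.
  rewrite big_split /=; congr (_ + _); case: eqP => [uv|_] /=; last first.
    by rewrite mul0r mulr0 big1 // => z _; rewrite /= ?mulr0n ?mulr0 ?mul0r.
  rewrite (bigD1 x) ?uv //= eqxx mulr1 mul1r vS big1 ?addr0 // => z /andP[_ /negbTE ->].
  by rewrite ?andbF ?mulr0n ?mulr0 ?mul0r.
rewrite big_ord_recl addn0 subn0 [m.+1.-1]/= mulrDr.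
rewrite [y * (_ * _) + _]addrC addrA; congr (_ + _).
rewrite (eq_bigr (fun z => psum (fun=> 1) m (z |: u) b +
  y * \sum_(j < m) psum (fun=> 1) j (z |: u) (v (n - m + j)%N) *
      psum w (m.-1 - j) (v (n - m + j).+1) b)); last first.
  by move=> z zu; apply: IH; rewrite ?cardsU1 ?zu ?uc; lia.
rewrite big_split /= psum1S; congr (_ + _).
rewrite -mulr_sumr exchange_big /=; congr (_ * _); apply: eq_bigr => j _.
rewrite -mulr_suml; congr (_ * _).
  rewrite -psum1S; congr (psum _ _ _ (v _)).
  by rewrite /bump /= add1n; have := ltn_ord j; lia.
rewrite /bump /= add1n; have jm := ltn_ord j.
congr (psum _ _ (v _) _); lia.
Qed.

End PathSums.

Section Middle.
Variables (R : realType) (d : nat) (p : R).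
Local Notation V := {set 'I_d}.
Local Notation T := (V * 'I_d)%type.
Local Notation e := (expR 1 : R).
Implicit Types (S a b u : V) (x : 'I_d) (s t : seq 'I_d) (H : {set T}).

Definition mem_wt H : T -> R := fun ed => (ed \in H)%:R.

Lemma prod_mem_wt H (A : seq T) :
  \prod_(ed <- A) mem_wt H ed = (all (fun ed => ed \in H) A)%:R.
Proof.
elim: A => [|ed A IH] /=; first by rewrite big_nil.
by rewrite big_cons IH /mem_wt -natrM mulnb.
Qed.

Lemma Ex_all_mem (A : seq T) : uniq A ->
  Ex p (fun H => (all (fun ed => ed \in H) A)%:R) = p ^+ size A.
Proof.
move=> uA; rewrite -(card_uniqP uA) -[#|A|]cardsE -Ex_subset; apply: eq_Ex => H.
congr (_ %:R); congr nat_of_bool; apply/allP/fintype.subsetP => h ed.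
  by rewrite inE; exact: h.
by move=> edA; apply: h; rewrite inE.
Qed.

Lemma Ex_two_lists (A B : seq T) : uniq A -> uniq B ->
  Ex p (fun H => \prod_(ed <- A) mem_wt H ed * \prod_(ed <- B) mem_wt H ed) =
  p ^+ size A * \prod_(ed <- B) (if ed \in A then 1 else p).
Proof.
move=> uA uB; pose C := A ++ [seq ed <- B | ed \notin A].
have uC : uniq C.
  rewrite cat_uniq uA filter_uniq // andbT; apply/hasPn => ed.
  by rewrite mem_filter => /andP[].
transitivity (Ex p (fun H => (all (fun ed => ed \in H) C)%:R)).
  apply: eq_Ex => H; rewrite !prod_mem_wt -natrM mulnb all_cat.
  congr (_ %:R); congr nat_of_bool; have [/allP aA|//] := boolP (all _ A).
  apply/allP/allP => h ed; first by rewrite mem_filter => /andP[_]; exact: h.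
  move=> edB; have [/aA//|edA] := boolP (ed \in A).
  by apply: h; rewrite mem_filter edA.
rewrite Ex_all_mem // size_cat exprD; congr (_ * _).
rewrite (bigID (fun ed => ed \in A)) /= big1 ?mul1r; last by move=> ed ->.
rewrite (eq_bigr (fun=> p)); last by move=> ed /negbTE ->.
by rewrite big_const_seq size_filter -Monoid.iteropE.
Qed.

Definition paths_in H n a b : R := psum (mem_wt H) n a b.

Lemma paths_in_gt0 H n a b : 0 < paths_in H n a b ->
  exists s, [/\ size s = n, upath H a s & endp a s = b].
Proof.
rewrite /paths_in psumE => h.
have [s sP hs] : exists2 s, s \in upaths n a b & 0 < \prod_(ed <- pedges a s) mem_wt H ed.
  apply/hasP; apply: contraTT h => /hasPn no; rewrite -leNgt big_seq.
  by apply: sumr_le0 => s sP; rewrite leNgt; exact: no.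
have [sn Hs es] := upathsP sP; exists s; split => //.
rewrite upathE Hs /=; move: hs; rewrite prod_mem_wt.
by case: (all _ _) => //; rewrite ltxx.
Qed.

Hypothesis p01 : 0 < p <= 1.
Let p0 : 0 < p. Proof. by case/andP: p01. Qed.

Lemma Ex_paths_in n a b : Ex p (fun H => paths_in H n a b) =
  p ^+ n * psum (fun=> 1) n a b.
Proof.
rewrite psumE mulr_sumr.
transitivity (Ex p (fun H => \sum_(s <- upaths n a b)
    (all (fun ed => ed \in H) (pedges a s))%:R)).
  apply: eq_Ex => H; rewrite /paths_in psumE; apply: eq_bigr => s _.
  exact: prod_mem_wt.
rewrite Ex_sum; apply: eq_big_seq => s /upathsP[sn Hs _].
by rewrite Ex_all_mem ?pedges_uniq // size_pedges sn big1 // mulr1.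
Qed.

(** Given that a path s is open, an edge of a second path is open with probability 1 if shared and p
    otherwise, that is p (1 + y) or p with y = (1-p)/p. B bounds the resulting weighted count
    uniformly in s. *)
Lemma Ex_paths_in_pair n a b a' b' B :
  (forall s, upath [set: T] a s -> size s = n -> endp a s = b ->
     psum (fun ed => 1 + (1 - p) / p * (ed \in pedges a s)%:R) n a' b' <= B) ->
  Ex p (fun H => paths_in H n a b * paths_in H n a' b') <=
  p ^+ n * p ^+ n * B * psum (fun=> 1) n a b.
Proof.
move=> hB.
have -> : Ex p (fun H => paths_in H n a b * paths_in H n a' b') =
    \sum_(s <- upaths n a b) \sum_(s' <- upaths n a' b')
      Ex p (fun H => \prod_(ed <- pedges a s) mem_wt H ed *
                     \prod_(ed <- pedges a' s') mem_wt H ed).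
  transitivity (Ex p (fun H => \sum_(s <- upaths n a b) \sum_(s' <- upaths n a' b')
      \prod_(ed <- pedges a s) mem_wt H ed * \prod_(ed <- pedges a' s') mem_wt H ed)).
    apply: eq_Ex => H; rewrite /paths_in !psumE mulr_suml.
    by apply: eq_bigr => s _; rewrite mulr_sumr.
  by rewrite Ex_sum; apply: eq_bigr => s _; rewrite Ex_sum.
rewrite [X in _ <= _ * X]psumE mulr_sumr big_seq [leRHS]big_seq.
apply: ler_sum => s sP; have [sn Hs es] := upathsP sP.
rewrite [X in _ <= _ * X]big1 // mulr1.
apply: (@le_trans _ _ (p ^+ n * (p ^+ n *
  psum (fun ed => 1 + (1 - p) / p * (ed \in pedges a s)%:R) n a' b'))); last first.
  rewrite -mulrA; do 2 (apply: ler_wpM2l; first by rewrite exprn_ge0 // ltW).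
  exact: hB.
rewrite -psum_scale psumE mulr_sumr le_eqVlt; apply/orP; left; apply/eqP.
apply: eq_big_seq => s' /upathsP[sn' Hs' es'].
rewrite Ex_two_lists ?pedges_uniq // size_pedges sn; congr (_ * _).
apply: eq_bigr => ed _; case: (ed \in _); rewrite ?mulr0 ?addr0 ?mulr1 //=.
by rewrite mulrDr mulr1 mulrCA mulfV ?gt_eqF // mulr1 addrC subrK.
Qed.

End Middle.

Section MiddleConnect.
Variable R : realType.
Local Notation e := (expR 1 : R).

(** Here g k starts on the path s itself, k steps before its end. Bounding plain path counts by
    factorials turns [psum_shared] into the recurrence of [diag_bound] and [cross_bound]. *)
Lemma shared_rec d y (a b : {set 'I_d}) (s : seq 'I_d) n m : 0 <= y ->
  upath [set: {set 'I_d} * 'I_d] a s -> size s = n -> (m <= n)%N ->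
  let g k := psum (fun ed => 1 + y * (ed \in pedges a s)%:R : R) k
               (endp a (take (n - k) s)) b in
  g m <= m`!%:R + y * \sum_(j < m) j`!%:R * g (m.-1 - j)%N.
Proof.
move=> y0 Hs sn mn /=; rewrite (psum_shared _ _ Hs sn) //; last first.
  have : upath [set: {set 'I_d} * 'I_d] a (take (n - m) s).
    by move: Hs; rewrite -{1}(cat_take_drop (n - m) s) upath_cat => /andP[].
  by move=> /card_endp ->; rewrite size_takel // sn leq_subr.
apply: lerD; first exact: psum1_le.
apply: ler_wpM2l => //; apply: ler_sum => j _; have jm := ltn_ord j.
have -> : (n - (m.-1 - j) = (n - m + j).+1)%N by lia.
apply: ler_wpM2r; last exact: psum1_le.
by apply: psum_ge0 => ed; rewrite addr_ge0 // mulr_ge0.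
Qed.

(** With mu the mean number of paths for one pair, the K diagonal terms are at most C1 mu^2 and the
    others at most (1 + C2/n) mu^2, to be compared with (K mu)^2. For p = alpha/d the condition on y
    = (1-p)/p says that alpha exceeds e with room to spare. *)
Lemma middle_connect (eta rho : R) : 0 < eta -> 0 <= rho < 1 ->
  exists2 C, 0 < C & forall d (p : R) n K h (a b : 'I_K -> {set 'I_d}),
    0 < p <= 1 -> (0 < n)%N -> (0 < K)%N ->
    (1 + eta) * ((1 - p) / p) * e <= rho * n%:R ->
    injective a -> injective b -> (forall i, a i \subset b i) ->
    (forall i, #|a i| = h) -> (forall i, #|b i| = (h + n)%N) ->
    1 <= Ex p (fun H => (0 < \sum_i paths_in R H n (a i) (b i))%R%:R) *
         (1 + C / K%:R + C / n%:R).
Proof.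
move=> eta0 rho01; have [C1 C10 HC1] := diag_bound eta0 rho01.
have [C2 C20 HC2] := cross_bound eta0 rho01.
exists (C1 + C2); first lra.
move=> d p n K h a b p01 n0 K0 yn ai bi ab ca cb.
have [p0 p1] : 0 < p /\ p <= 1 by case/andP: p01.
have p01' : 0 <= p <= 1 by rewrite ltW.
set y := (1 - p) / p in yn *.
have y0 : 0 <= y by rewrite divr_ge0 //; lra.
have cnt i : psum (fun=> 1) n (a i) (b i) = n`!%:R :> R.
  by rewrite psum1E ab ca cb eqxx.
pose mu : R := p ^+ n * n`!%:R.
have mu0 : 0 < mu by rewrite mulr_gt0 ?exprn_gt0 // ltr0n fact_gt0.
pose f (H : {set {set 'I_d} * 'I_d}) := \sum_i paths_in R H n (a i) (b i).
have f0 H : 0 <= f H.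
  apply: sumr_ge0 => i _; apply: psum_ge0 => ed; exact: ler0n.
have Ef : Ex p f = K%:R * mu.
  rewrite /f Ex_sum (eq_bigr (fun=> mu)); first by rewrite sumr_const card_ord mulr_natl.
  by move=> i _; rewrite Ex_paths_in cnt.
have diag i : Ex p (fun H => paths_in R H n (a i) (b i) * paths_in R H n (a i) (b i)) <=
  mu ^+ 2 * C1.
  apply: le_trans (Ex_paths_in_pair (B := C1 * n`!%:R) p01 _) _; last first.
    by rewrite cnt /mu le_eqVlt; apply/orP; left; apply/eqP; ring.
  move=> s Hs sn es.
  have := HC1 n y _ y0 yn (fun m mn => shared_rec (b i) y0 Hs sn mn).
  by rewrite subnn take0.
have cross i j : i != j ->
    Ex p (fun H => paths_in R H n (a i) (b i) * paths_in R H n (a j) (b j)) <=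
      mu ^+ 2 * (1 + C2 / n%:R).
  move=> ij; apply: le_trans (Ex_paths_in_pair (B := (1 + C2 / n%:R) * n`!%:R) p01 _) _;
    last first.
    by rewrite cnt /mu le_eqVlt; apply/orP; left; apply/eqP; ring.
  move=> s Hs sn es; rewrite (psum_shared _ _ Hs sn) ?subnn ?addn0 ?ca //.
  pose g k := psum (fun ed => 1 + y * (ed \in pedges (a i) s)%:R : R) k
               (endp (a i) (take (n - k) s)) (b j).
  apply: le_trans (HC2 n y g n0 y0 yn _ _); last 2 first.
  - rewrite /g subn0 take_oversize ?sn // es psum0 (inj_eq bi) (negbTE ij).
    by rewrite lexx.
  - by move=> m /andP[_ mn]; exact: shared_rec.
  apply: lerD; first exact: psum1_le.
  apply: ler_wpM2l => //.
  rewrite -(big_mkord xpredT (fun k => psum (fun=> 1) k (a j) (endp (a i) (take (0 + k) s)) *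
    psum _ (n.-1 - k) (endp (a i) (take (0 + k).+1 s)) (b j))).
  (* The term k = 0 would require a j = a i. *)
  rewrite big_ltn // take0 psum0 (inj_eq ai) eq_sym (negbTE ij) mul0r add0r.
  rewrite 2!big_nat; apply: ler_sum => k /andP[k1 kn]; rewrite add0n /g.
  have -> : (n - (n.-1 - k) = k.+1)%N by move: kn; clear; lia.
  apply: ler_wpM2r; last exact: psum1_le.
  by apply: psum_ge0 => ed; rewrite addr_ge0 // mulr_ge0.
have Ef2 : Ex p (fun H => f H ^+ 2) <=
    (K%:R * mu) ^+ 2 * (1 + C1 / K%:R + C2 / n%:R).
  have -> : Ex p (fun H => f H ^+ 2) = \sum_i \sum_j
      Ex p (fun H => paths_in R H n (a i) (b i) * paths_in R H n (a j) (b j)).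
    transitivity (Ex p (fun H => \sum_i \sum_j
        paths_in R H n (a i) (b i) * paths_in R H n (a j) (b j))).
      apply: eq_Ex => H; rewrite expr2 /f mulr_suml.
      by apply: eq_bigr => i _; rewrite mulr_sumr.
    by rewrite Ex_sum; apply: eq_bigr => i _; rewrite Ex_sum.
  apply: (@le_trans _ _ (\sum_(i < K) (mu ^+ 2 * C1 + K%:R * (mu ^+ 2 * (1 + C2 / n%:R))))).
    apply: ler_sum => i _; rewrite (bigD1 i) //=; apply: lerD; first exact: diag.
    apply: (@le_trans _ _ (\sum_(j < K) mu ^+ 2 * (1 + C2 / n%:R))); last first.
      by rewrite sumr_const card_ord mulr_natl.
    rewrite [leRHS](bigD1 i) //=; apply: ler_wpDl.
      by rewrite mulr_ge0 ?sqr_ge0 // addr_ge0 // divr_ge0 // ltW.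
    by apply: ler_sum => j ji; apply: cross; rewrite eq_sym.
  rewrite sumr_const card_ord -mulr_natl.
  have Kn0 : K%:R != 0 :> R by rewrite pnatr_eq0 -lt0n.
  rewrite le_eqVlt; apply/orP; left; apply/eqP; field.
  by rewrite Kn0 pnatr_eq0 -lt0n n0.
have := second_moment p01' f0; rewrite Ef => h2.
set q := Ex p _ in h2 *.
have q0 : 0 <= q by apply: Ex_ge0 => // H; exact: ler0n.
have Kmu : 0 < (K%:R * mu) ^+ 2 by rewrite exprn_gt0 // mulr_gt0 // ltr0n.
have {h2} h2 := le_trans h2 (ler_wpM2l q0 Ef2).
rewrite [leRHS]mulrCA -[leLHS]mulr1 (ler_pM2l Kmu) in h2.
apply: le_trans h2 _; apply: ler_wpM2l => //.
have Ki : 0 <= K%:R^-1 :> R by rewrite invr_ge0.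
have ni : 0 <= n%:R^-1 :> R by rewrite invr_ge0.
by apply: lerD; [rewrite lerD2l|]; apply: ler_wpM2r => //; lra.
Qed.

End MiddleConnect.

(** * Branching from the bottom of the cube *)

Section FixedPointIteration.
Variable R : realType.
Implicit Types (alpha r : R) (h : nat).

Definition psi alpha r : R := 1 - expR (- (alpha * r)).

Lemma psi_le alpha r r' : 0 <= alpha -> r <= r' -> psi alpha r <= psi alpha r'.
Proof.
move=> a0 rr; rewrite /psi lerD2l lerN2 ler_expR lerN2.
exact: ler_wpM2l.
Qed.

Lemma psi_lt1 alpha r : psi alpha r < 1.
Proof. by rewrite /psi; have := expR_gt0 (- (alpha * r)); lra. Qed.

Lemma psi_ge0 alpha r : 0 <= alpha -> 0 <= r -> 0 <= psi alpha r.
Proof.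
move=> a0 r0; rewrite /psi subr_ge0 -[leRHS]expR0 ler_expR oppr_le0.
exact: mulr_ge0.
Qed.

Lemma iter_psi_itv alpha r h : 0 <= alpha -> 0 <= r <= 1 ->
  0 <= iter h (psi alpha) r <= 1.
Proof.
move=> a0 r01; elim: h => [//|h /andP[IH0 IH1]] /=.
by rewrite psi_ge0 // ltW // psi_lt1.
Qed.

Lemma iter_psi_le alpha r r' h : 0 <= alpha -> r <= r' ->
  iter h (psi alpha) r <= iter h (psi alpha) r'.
Proof. by move=> a0 rr; elim: h => [//|h IH] /=; exact: psi_le. Qed.

(** Since exp(-x) <= 1/(1+x), it suffices that (1 + alpha r)(1 - r) >= 1, which holds for 0 <= r <=
    (alpha-1)/alpha. Below this threshold the iteration increases. *)
Lemma le_psi alpha r : 1 < alpha -> 0 <= r <= (alpha - 1) / alpha -> r <= psi alpha r.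
Proof.
move=> a1 /andP[r0 ra]; rewrite /psi.
have a0 : 0 < alpha by lra.
have h1 := expR_ge1Dx (alpha * r).
have h2 : expR (alpha * r) * expR (- (alpha * r)) = 1.
  by rewrite -expRD subrr expR0.
set E := expR (- _) in h2 *.
have E0 : 0 < E by exact: expR_gt0.
have h3 : (1 + alpha * r) * E <= 1 by rewrite -[leRHS]h2 ler_pM2r.
have ar : alpha * r <= alpha - 1 by rewrite mulrC -ler_pdivlMr.
suff : (1 + alpha * r) * E <= (1 + alpha * r) * (1 - r).
  by rewrite ler_pM2l; [lra|have := mulr_ge0 (ltW a0) r0; lra].
apply: le_trans h3 _; nra.
Qed.

(** A bounded monotone sequence converges to a fixed point of [psi]; the lower bound c rules out the
    fixed point 0, and uniqueness of zeta does the rest. *)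
Lemma iter_psi_cvg_mono alpha r : 1 < alpha -> 0 < r <= 1 ->
  (exists2 c, 0 < c & forall h, c <= iter h (psi alpha) r) ->
  {homo (fun h => iter h (psi alpha) r) : m n / (m <= n)%N >-> m <= n} \/
  {homo (fun h => iter h (psi alpha) r) : m n / (m <= n)%N >-> n <= m} ->
  ((fun h => iter h (psi alpha) r) @ \oo --> zeta alpha)%classic.
Proof.
move=> a1 /andP[r0 r1] [c c0 cu] mono; set u := fun h => _ in mono cu *.
have a0 : 0 < alpha by lra.
have u01 h : 0 <= u h <= 1 by apply: iter_psi_itv; rewrite ltW //= ltW.
have cu' : (cvg (u @ \oo))%classic.
  case: mono => mono.
    by apply: nondecreasing_is_cvgn => //; exists 1 => _ [h _ <-]; case/andP: (u01 h).
  by apply: nonincreasing_is_cvgn => //; exists 0 => _ [h _ <-]; case/andP: (u01 h).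
set L := (lim (u @ \oo))%classic.
have uL : (u @ \oo --> L)%classic by exact: cu'.
have Lc : c <= L by apply: limr_ge => //; apply: nearW => h; exact: cu.
have psic : (continuous (psi alpha))%classic.
  move=> z; apply: cvgB; first exact: cvg_cst.
  apply: (@continuous_comp _ _ _ (fun z => - (alpha * z)) expR); last first.
    exact: continuous_expR.
  by apply: cvgN; apply: cvgM; [exact: cvg_cst|exact: cvg_id].
have uSL : ((fun h => u h.+1) @ \oo --> psi alpha L)%classic.
  have -> : (fun h => u h.+1) = psi alpha \o u by [].
  apply: (@cvg_comp _ _ _ u (psi alpha) _ (nbhs L)) => //; exact: psic.
have uSL' : ((fun h => u h.+1) @ \oo --> L)%classic.
  have -> : (fun h => u h.+1) = (fun h => u (h + 1)%N) by apply/funext => h; rewrite addn1.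
  by rewrite (cvg_shiftn 1 u).
have LE : L = psi alpha L by apply: (cvg_unique _ uSL' uSL).
have <- : L = zeta alpha; last exact: uL.
apply: (zetaP a1).2; split; last exact: LE.
by rewrite (lt_le_trans c0 Lc) LE psi_lt1.
Qed.

Lemma iter_psi_cvg alpha r : 1 < alpha -> 0 < r <= (alpha - 1) / alpha ->
  ((fun h => iter h (psi alpha) r) @ \oo --> zeta alpha)%classic.
Proof.
move=> a1 /andP[r0 ra]; have a0 : 0 < alpha by lra.
have r1 : r <= 1 by apply: le_trans ra _; rewrite ler_pdivrMr //; lra.
have step h : iter h (psi alpha) r <= iter h.+1 (psi alpha) r.
  elim: h => [|h IH] /=; last exact: (psi_le (ltW a0) IH).
  by apply: le_psi => //; rewrite ltW.
have mono : {homo (fun h => iter h (psi alpha) r) : m n / (m <= n)%N >-> m <= n}.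
  by apply: (@homo_leq _ _ <=%R) => //; exact: le_trans.
apply: iter_psi_cvg_mono => //; first by rewrite r0.
  by exists r => // h; exact: (mono 0%N).
by left.
Qed.

Lemma iter_psi1_cvg alpha : 1 < alpha ->
  ((fun h => iter h (psi alpha) 1) @ \oo --> zeta alpha)%classic.
Proof.
move=> a1; have a0 : 0 < alpha by lra.
pose c := (alpha - 1) / alpha.
have c0 : 0 < c by rewrite divr_gt0 //; lra.
have c1 : c <= 1 by rewrite ler_pdivrMr //; lra.
have stepc h : c <= iter h (psi alpha) c.
  elim: h => [//|h IH]; apply: le_trans (le_psi a1 _) _.
    by rewrite (ltW c0) lexx.
  exact: (psi_le (ltW a0) IH).
apply: iter_psi_cvg_mono => //; first by rewrite ltr01 lexx.
  by exists c => // h; apply: le_trans (stepc h) (iter_psi_le _ (ltW a0) c1).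
right; apply: (@homo_leq _ _ (fun x y => y <= x)) => [//|y x z h1 h2|h].
  exact: le_trans h2 h1.
elim: h => [|h IH] /=; first by rewrite ltW // psi_lt1.
exact: psi_le (ltW a0) IH.
Qed.

End FixedPointIteration.

(** * Survival for h levels and its upper bound *)

Section Alive.
Variable d : nat.
Local Notation V := {set 'I_d}.
Local Notation T := (V * 'I_d)%type.
Implicit Types (S : V) (x : 'I_d) (s : seq 'I_d) (H : {set T}) (h : nat).

Fixpoint alive h S H : bool :=
  if h is h'.+1 then [exists x, [&& x \notin S, (S, x) \in H & alive h' (x |: S) H]]
  else true.

Definition levels (i j : nat) : {set T} := [set ed : T | (i <= #|ed.1| < j)%N].

Lemma aliveP h S H : reflect (exists2 s, size s = h & upath H S s) (alive h S H).
Proof.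
apply: (iffP idP); elim: h S => [|h IH] S /=; first by exists [::].
- case/existsP => x /and3P[xS xH /IH[s <- Hs]]; exists (x :: s) => //=.
  by rewrite xS xH.
- by [].
- case=> -[//|x s] /= [sh] /and3P[xS xH Hs]; apply/existsP; exists x.
  by rewrite xS xH IH //; exists s.
Qed.

Lemma alive_agree h S H H' :
  (forall (A : V) x, S \subset A -> (#|A| < #|S| + h)%N -> x \notin A ->
     ((A, x) \in H) = ((A, x) \in H')) -> alive h S H = alive h S H'.
Proof.
elim: h S => [//|h IH] S /= HH; apply: eq_existsb => x.
have [xS|//] := boolP (x \notin S); rewrite HH ?addnS ?ltnS ?leq_addr //=.
congr (_ && _); apply: IH => A y SA cA yA; apply: HH => //.
  by rewrite (subset_trans _ SA) // subsetUr.
by move: cA; rewrite cardsU1 xS add1n addSnnS.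
Qed.

Lemma alive_mono h S H H' : H \subset H' -> alive h S H -> alive h S H'.
Proof.
move=> /fintype.subsetP HH; elim: h S => [//|h IH] S /= /existsP[x /and3P[xS xH aH]].
by apply/existsP; exists x; rewrite xS HH //= IH.
Qed.

End Alive.

Section AliveBound.
Variable R : realType.

Lemma expr_1sub_ge (t : R) n : 0 <= t <= 1/2 ->
  expR (- (n%:R * t)) - 2 * n%:R * t ^+ 2 <= (1 - t) ^+ n.
Proof.
move=> /andP[t0 t1]; have d0 : 0 < 1 - t by lra.
(* For t <= 1/2, 1/(1-t) <= 1 + t + 2 t^2. *)
have h1 : expR (- (t + 2 * t ^+ 2)) <= 1 - t.
  rewrite expRN -[leRHS]invrK lef_pV2 ?posrE ?invr_gt0 ?expR_gt0 //.
  apply: le_trans (expR_ge1Dx _).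
  by rewrite -[leLHS]mul1r ler_pdivrMr //; nra.
apply: (@le_trans _ _ (expR (- (t + 2 * t ^+ 2)) ^+ n)); last first.
  by rewrite lerXn2r ?nnegrE ?expR_ge0 // ltW.
rewrite -expRM_natl.
have -> : n%:R * - (t + 2 * t ^+ 2) = - (n%:R * t) + - (2 * n%:R * t ^+ 2) by ring.
rewrite expRD; set a := n%:R * t; set b := 2 * _ * _.
have a0 : 0 <= a by rewrite mulr_ge0.
have b0 : 0 <= b by rewrite !mulr_ge0.
have e1 : expR (- a) <= 1 by rewrite -[leRHS]expR0 ler_expR oppr_le0.
have e0 := expR_ge0 (- a).
have := expR_ge1Dx (- b); nra.
Qed.

Lemma expRN_lip (a b : R) : 0 <= a -> 0 <= b -> expR (- a) - b <= expR (- (a + b)).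
Proof.
move=> a0 b0; rewrite opprD expRD.
have e1 : expR (- a) <= 1 by rewrite -[leRHS]expR0 ler_expR oppr_le0.
have e0 := expR_ge0 (- a).
have := expR_ge1Dx (- b); nra.
Qed.

(** The failures of the children are decreasing events, so however their paths merge, all fail with
    probability at least the product (1 - p v)^d. A direction already in S counts as a sure failure,
    which makes the bound uniform in S. *)
Lemma alive_ub (alpha : R) h : 0 < alpha ->
  exists2 c, 0 <= c & forall d (S : {set 'I_d}), 2 * alpha <= d%:R ->
    Ex (alpha / d%:R) (fun H => (alive h S H)%:R) <= iter h (psi alpha) 1 + c / d%:R.
Proof.
move=> a0; elim: h => [|h [c c0 IH]].
  by exists 0 => // d S _; rewrite /= Ex_cst mul0r addr0.
exists (alpha * c + 2 * alpha ^+ 2); first by rewrite addr_ge0 ?mulr_ge0 ?sqr_ge0 // ltW.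
move=> d S ad; set p := alpha / d%:R.
have dR : 0 < d%:R :> R by lra.
have p0 : 0 <= p by rewrite divr_ge0 // ltW.
have p2 : p <= 1/2 by rewrite /p ler_pdivrMr //; lra.
have p01 : 0 <= p <= 1 by rewrite p0 /=; lra.
pose q := iter h (psi alpha) 1.
have /andP[q0 q1] : 0 <= q <= 1 by apply: iter_psi_itv; [exact: ltW|rewrite ler01 lexx].
(* The cap at 1 keeps p v below 1/2 even when c / d is large. *)
pose v := Num.min 1 (q + c / d%:R).
have qc0 : 0 <= q + c / d%:R by rewrite addr_ge0 // divr_ge0 // ltW.
have v0 : 0 <= v by rewrite le_min ler01 qc0.
have v1 : v <= 1 by rewrite ge_min lexx.
have av (A : {set 'I_d}) : Ex p (fun H => (alive h A H)%:R) <= v.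
  rewrite le_min IH // andbT -[leRHS](Ex_cst ({set 'I_d} * 'I_d)%type p).
  by apply: le_Ex => // H; case: (alive h A H).
pose F x (H : {set {set 'I_d} * 'I_d}) : R :=
  (~~ [&& x \notin S, (S, x) \in H & alive h (x |: S) H])%:R.
have EF x : 1 - p * v <= Ex p (F x).
  have [xS|xS] := boolP (x \in S).
    have -> : Ex p (F x) = 1.
      by rewrite -[RHS](Ex_cst ({set 'I_d} * 'I_d)%type p); apply: eq_Ex => H; rewrite /F xS.
    by rewrite gerBl mulr_ge0.
  have -> : Ex p (F x) = 1 - Ex p (fun H =>
    ([set (S, x)] \subset H)%:R * (alive h (x |: S) H)%:R).
    rewrite -[X in _ = X - _](Ex_cst ({set 'I_d} * 'I_d)%type p) -ExB; apply: eq_Ex => H.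
    rewrite /F xS /= sub1set -natrM mulnb.
    by case: (_ && _); rewrite /= ?subr0 ?subrr.
  rewrite lerB // (@Ex_indep _ _ p [set (S, x)]).
  - by rewrite Ex_subset cards1 expr1 ler_wpM2l.
  - by move=> H /=; rewrite subsetI subxx andbT.
  move=> H /=; congr (_ %:R); congr nat_of_bool; apply: alive_agree => A y xSA _ _.
  rewrite !inE xpair_eqE; case: eqP => [AS|]; rewrite ?andbT //=.
  by move: xSA; rewrite AS subUset sub1set (negbTE xS).
have Fa x : antitone (F x).
  move=> H H' HH; rewrite /F ler_nat.
  have : [&& x \notin S, (S, x) \in H & alive h (x |: S) H] ->
         [&& x \notin S, (S, x) \in H' & alive h (x |: S) H'].
    by move=> /and3P[-> xH aH]; rewrite (fintype.subsetP HH _ xH) (alive_mono HH aH).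
  by case: [&& _, _ & _] => [->|] //; case: [&& _, _ & _].
have F0 x H : 0 <= F x H by exact: ler0n.
have -> : Ex p (fun H => (alive h.+1 S H)%:R) =
    1 - Ex p (fun H => \prod_(x <- index_enum 'I_d) F x H).
  rewrite -[X in X - _](Ex_cst ({set 'I_d} * 'I_d)%type p) -ExB; apply: eq_Ex => H.
  case: (boolP (alive h.+1 S H)) => [/existsP[x xP]|].
    suff -> : \prod_(x <- index_enum 'I_d) F x H = 0 by rewrite subr0.
    by apply/eqP; rewrite prodf_seq_eq0; apply/hasP; exists x;
      rewrite ?mem_index_enum // /F xP /=.
  rewrite negb_exists => /forallP xP.
  by rewrite big1 ?subrr // => x _; rewrite /F (xP x).
have := harris_prod p01 (index_enum 'I_d) Fa F0.
set E := Ex p _ => hE.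
have h1 : (1 - p * v) ^+ d <= E.
  apply: le_trans hE; rewrite -[X in _ ^+ X]card_ord -prodr_const.
  apply: ler_prod => x _; rewrite EF andbT subr_ge0.
  by rewrite (le_trans (ler_wpM2l p0 v1)) // mulr1; lra.
have pv : 0 <= p * v <= 1/2.
  by rewrite mulr_ge0 //= (le_trans (ler_wpM2l p0 v1)) // mulr1.
have := expr_1sub_ge d pv; have -> : d%:R * (p * v) = alpha * v by rewrite /p; field; lra.
move=> h2.
have h3 : 2 * d%:R * (p * v) ^+ 2 <= 2 * alpha ^+ 2 / d%:R.
  have -> : 2 * d%:R * (p * v) ^+ 2 = 2 * alpha ^+ 2 / d%:R * v ^+ 2 by rewrite /p; field; lra.
  rewrite -[leRHS]mulr1; apply: ler_wpM2l; last by rewrite expr_le1.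
  by rewrite divr_ge0 ?mulr_ge0 ?sqr_ge0 // ltW.
have h4 : expR (- (alpha * q)) - alpha * c / d%:R <= expR (- (alpha * v)).
  apply: le_trans (expRN_lip _ _) _.
  - by rewrite mulr_ge0 // ltW.
  - by rewrite !mulr_ge0 ?invr_ge0 // ltW.
  rewrite ler_expR lerN2 -mulrA -mulrDr; apply: ler_wpM2l; first exact: ltW.
  by rewrite ge_min lexx orbT.
rewrite /= -/q /psi mulrDl; lra.
Qed.

End AliveBound.

(** * Exploration of disjoint subcubes *)

Section Exploration.
Variable d : nat.
Local Notation V := {set 'I_d}.
Local Notation T := (V * 'I_d)%type.
Implicit Types (S W N A : V) (x : 'I_d) (s : seq 'I_d) (H : {set T}) (h : nat).

Definition open_dirs S W H : V := [set x in W | (S, x) \in H].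

(* Removing all open directions at S from W makes the subcubes explored from the different
   children x |: S disjoint, hence their explorations independent. *)
Fixpoint explore h S W H : {set V} :=
  if h is h'.+1 then
    \bigcup_(x in open_dirs S W H) explore h' (x |: S) (W :\: open_dirs S W H) H
  else [set S].

(** The exploration after its first step, with the set N of open directions frozen: it reads only
    edges above S, hence is independent of N. *)
Definition explore_from h S N W H : {set V} :=
  \bigcup_(x in N) explore h (x |: S) (W :\: N) H.

Definition interval S W : {set T} := [set ed : T | S \subset ed.1 & ed.1 \subset S :|: W].

Lemma disjoint_setU1D S N W x : [disjoint S & W] -> x \in N ->
  [disjoint x |: S & W :\: N].
Proof.
move=> dSW xN; rewrite disjoints_subset subUset sub1set !inE xN /=.
rewrite -disjoints_subset; apply: (fintype.disjointWr _ dSW); exact: subsetDl.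
Qed.

Lemma exploreP h S W H A : [disjoint S & W] -> A \in explore h S W H ->
  A \subset S :|: W /\ exists s, [/\ size s = h, upath H S s & endp S s = A].
Proof.
elim: h S W => [|h IH] S W dSW /=.
  by rewrite inE => /eqP ->; split; [exact: subsetUl|exists [::]].
case/bigcupP => x xN /IH[]; first exact: disjoint_setU1D.
have [xW xH] : x \in W /\ (S, x) \in H by move: xN; rewrite inE => /andP[].
move=> Asub [s [sh Hs es]]; split.
  apply: subset_trans Asub _; rewrite -setUA subUset sub1set inE xW orbT /=.
  by rewrite setUS // subsetDl.
exists (x :: s); split => //=; first by rewrite sh.
by rewrite xH Hs (disjointFl dSW xW).
Qed.

Lemma explore_sub h S W H A : [disjoint S & W] -> A \in explore h S W H -> S \subset A.
Proof. by move=> dSW /(exploreP dSW)[_ [s [_ _ <-]]]; exact: sub_endp. Qed.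

(** A vertex reached through x contains x and no other element of N, so the union is disjoint. *)
Lemma card_explore_from h S N W H : [disjoint S & W] -> N \subset W ->
  #|explore_from h S N W H| = (\sum_(x in N) #|explore h (x |: S) (W :\: N) H|)%N.
Proof.
move=> dSW NW.
pose F x := if x \in N then explore h (x |: S) (W :\: N) H else set0.
have FE : explore_from h S N W H = \bigcup_x F x.
  by rewrite /explore_from [RHS](bigID (mem N)) /= [X in _ :|: X]big1 ?setU0;
    [apply: eq_bigr => x xN; rewrite /F xN|move=> x /negbTE xN; rewrite /F xN].
rewrite FE -sum1_card partition_disjoint_bigcup.
  rewrite [RHS]big_mkcond; apply: eq_bigr => x _; rewrite /F sum1_card.
  by case: ifP; rewrite ?cards0.
move=> x y xy; rewrite /F -setI_eq0; case: ifP => xN; last by rewrite set0I.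
case: ifP => yN; last by rewrite setI0.
apply/set0Pn => -[A]; rewrite inE => /andP[Ax Ay].
have xA : x \in A.
  apply: (fintype.subsetP (explore_sub _ Ax)); first exact: disjoint_setU1D.
  by rewrite !inE eqxx.
have [/fintype.subsetP/(_ x xA) + _] := exploreP (disjoint_setU1D dSW yN) Ay.
rewrite !inE xN (negbTE xy) /= orbF.
by rewrite (disjointFl dSW) // (fintype.subsetP NW).
Qed.

Lemma explore_agree h S W H H' :
  (forall A x, S \subset A -> A \subset S :|: W -> (#|S| <= #|A| < #|S| + h)%N ->
     ((A, x) \in H) = ((A, x) \in H')) -> [disjoint S & W] ->
  explore h S W H = explore h S W H'.
Proof.
elim: h S W => [//|h IH] S W HH dSW /=.
have <- : open_dirs S W H = open_dirs S W H'.
  apply/setP => x; rewrite !inE HH ?subxx ?subsetUl //.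
  by rewrite leqnn addnS ltnS leq_addr.
apply: eq_bigr => x xN; have xW : x \in W by move: xN; rewrite inE => /andP[].
have xS : x \notin S by rewrite (disjointFl dSW xW).
apply: IH; last exact: disjoint_setU1D.
move=> A y xSA AW; rewrite cardsU1 xS add1n => cA; apply: HH.
- by rewrite (subset_trans _ xSA) // subsetUr.
- apply: subset_trans AW _; rewrite -setUA subUset sub1set inE xW orbT /=.
  by rewrite setUS // subsetDl.
by move: cA => /andP[c1 c2]; rewrite ltnW //= -addSnnS.
Qed.

Lemma explore_from_agree h S N W H H' :
  (forall (A : V) x, (#|S| < #|A| < #|S| + h.+1)%N ->
     ((A, x) \in H) = ((A, x) \in H')) -> [disjoint S & W] -> N \subset W ->
  explore_from h S N W H = explore_from h S N W H'.
Proof.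
move=> HH dSW NW; apply: eq_bigr => x xN; apply: explore_agree; last exact: disjoint_setU1D.
have xW := fintype.subsetP NW _ xN.
move=> A y _ _; rewrite cardsU1 (disjointFl dSW xW) add1n => cA; apply: HH.
by rewrite -addSnnS.
Qed.

End Exploration.

Section ExplorationLaplace.
Variable R : realType.

Lemma prod_le_expr (I : Type) (r : seq I) (a : I -> R) (q delta : R) :
  0 <= q <= 1 -> 0 <= delta -> (forall i, 0 <= a i <= 1) -> (forall i, a i <= q + delta) ->
  \prod_(i <- r) a i <= q ^+ size r + (size r)%:R * delta.
Proof.
move=> /andP[q0 q1] de0 a01 aq; elim: r => [|i r IH] /=.
  by rewrite big_nil expr0 mul0r addr0.
rewrite big_cons exprS; have /andP[ai0 ai1] := a01 i.
apply: le_trans (ler_wpM2l ai0 IH) _; rewrite mulrDr -natr1.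
have h1 : a i * q ^+ size r <= (q + delta) * q ^+ size r.
  by rewrite ler_wpM2r // exprn_ge0.
have h2 : a i * ((size r)%:R * delta) <= (size r)%:R * delta.
  by rewrite ler_piMl // mulr_ge0.
have h3 : q ^+ size r * delta <= delta by rewrite ler_piMl // exprn_ile1.
by lra.
Qed.

Lemma prod_le_expr_in (I : eqType) (r : seq I) (a : I -> R) (q delta : R) :
  0 <= q <= 1 -> 0 <= delta -> {in r, forall i, 0 <= a i <= 1 /\ a i <= q + delta} ->
  \prod_(i <- r) a i <= q ^+ size r + (size r)%:R * delta.
Proof.
move=> q01 de0 ar; have /andP[q0 q1] := q01.
pose b i := if i \in r then a i else 0.
rewrite (eq_big_seq b); last by move=> i ir; rewrite /b ir.
apply: prod_le_expr => // i; rewrite /b; case: ifPn => [/ar[]//|_].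
  by rewrite lexx ler01.
by rewrite addr_ge0.
Qed.

(** The explorations from the children add up in size and read disjoint sets of edges, so the
    Laplace transform factorises. *)
Lemma Ex_laplace_explore_from d (p s : R) h (S N W : {set 'I_d}) : 
  [disjoint S & W] -> N \subset W ->
  Ex p (fun H => s ^+ #|explore_from h S N W H|) =
  \prod_(x <- enum N) Ex p (fun H => s ^+ #|explore h (x |: S) (W :\: N) H|).
Proof.
move=> dSW NW.
rewrite -(@Ex_prod _ _ p _ _ _ (fun x => interval (x |: S) (W :\: N))).
- apply: eq_Ex => H; rewrite card_explore_from // -big_enum /=.
  by rewrite (big_morph _ (fun m n => exprD s m n) (expr0 s)).
- exact: enum_uniq.
- move=> x; rewrite mem_enum => xN H.
  rewrite (@explore_agree _ h (x |: S) (W :\: N) H (H :&: interval (x |: S) (W :\: N))) //.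
    2: exact: disjoint_setU1D.
  by move=> A y A1 A2 _; rewrite !inE /= A1 A2 !andbT.
move=> x y; rewrite !mem_enum => xN yN xy; rewrite -setI_eq0; apply/set0Pn => -[[A z]].
rewrite !inE /= => /andP[/andP[xA _] /andP[_ Ay]].
have {}xA : x \in A by rewrite (fintype.subsetP xA) // !inE eqxx.
move: (fintype.subsetP Ay x xA); rewrite !inE xN (negbTE xy) /= orbF.
by rewrite (disjointFl dSW) // (fintype.subsetP NW).
Qed.

Section OpenDirections.
Variables (d : nat) (p : R) (S W : {set 'I_d}).
Local Notation T := ({set 'I_d} * 'I_d)%type.

Lemma card_open_dirs (H : {set T}) :
  (#|open_dirs S W H|)%:R = \sum_(x in W) ((S, x) \in H)%:R :> R.
Proof.
rewrite -sum1_card natr_sum big_mkcond [RHS]big_mkcond; apply: eq_bigr => x _.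
by rewrite inE; case: (x \in W) => //=; case: (_ \in H).
Qed.

Lemma Ex_mem1 (ed : T) : Ex p (fun H => (ed \in H)%:R) = p.
Proof.
transitivity (Ex p (fun H : {set T} => ([set ed] \subset H)%:R)).
  by apply: eq_Ex => H; rewrite sub1set.
by rewrite Ex_subset cards1 expr1.
Qed.

Lemma Ex_card_open_dirs : Ex p (fun H => (#|open_dirs S W H|)%:R) = p * #|W|%:R.
Proof.
under eq_Ex do rewrite card_open_dirs.
rewrite Ex_sum (eq_bigr (fun=> p)); last by move=> x _; exact: Ex_mem1.
by rewrite sumr_const mulr_natr.
Qed.

Lemma Ex_sqr_card_open_dirs : 0 <= p <= 1 ->
  Ex p (fun H => (#|open_dirs S W H|)%:R ^+ 2) <= p * #|W|%:R + (p * #|W|%:R) ^+ 2.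
Proof.
move=> /andP[p0 p1].
have -> : Ex p (fun H => (#|open_dirs S W H|)%:R ^+ 2) =
    \sum_(x in W) \sum_(y in W) Ex p (fun H => ((S, x) \in H)%:R * ((S, y) \in H)%:R).
  transitivity (Ex p (fun H => \sum_(x in W) \sum_(y in W)
      ((S, x) \in H)%:R * ((S, y) \in H)%:R)).
    apply: eq_Ex => H; rewrite card_open_dirs expr2 mulr_suml.
    by apply: eq_bigr => x _; rewrite mulr_sumr.
  by rewrite Ex_sum; apply: eq_bigr => x _; rewrite Ex_sum.
apply: (@le_trans _ _ (\sum_(x in W) (p + #|W|%:R * p ^+ 2))); last first.
  by rewrite sumr_const -mulr_natl le_eqVlt; apply/orP; left; apply/eqP; ring.
apply: ler_sum => x xW; rewrite (bigD1 x) //=; apply: lerD.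
  rewrite le_eqVlt; apply/orP; left; apply/eqP; rewrite -[RHS](Ex_mem1 (S, x)).
  by apply: eq_Ex => H; rewrite -natrM mulnb andbb.
apply: (@le_trans _ _ (\sum_(y in W) p ^+ 2)); last by rewrite sumr_const mulr_natl.
rewrite [leRHS](bigD1 x) //=; apply: ler_wpDl; first exact: sqr_ge0.
apply: ler_sum => y /andP[_ yx]; rewrite le_eqVlt; apply/orP; left; apply/eqP.
transitivity (Ex p (fun H : {set T} => ([set (S, x); (S, y)] \subset H)%:R)).
  by apply: eq_Ex => H; rewrite subUset !sub1set -natrM mulnb.
by rewrite Ex_subset cards2 xpair_eqE eqxx /= eq_sym yx.
Qed.

Lemma Ex_expr_card_open_dirs (q : R) :
  Ex p (fun H => q ^+ #|open_dirs S W H|) = (1 - p * (1 - q)) ^+ #|W|.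
Proof.
pose F x (H : {set T}) : R := if (S, x) \in H then q else 1.
transitivity (Ex p (fun H => \prod_(x <- enum W) F x H)).
  apply: eq_Ex => H; rewrite big_enum /= -[LHS]prodr_const.
  rewrite big_mkcond [RHS]big_mkcond; apply: eq_bigr => x _ /=.
  by rewrite /F inE; case: (x \in W).
rewrite (@Ex_prod _ _ p _ _ _ (fun x => [set (S, x)])) ?enum_uniq //.
- rewrite big_enum /= -prodr_const; apply: eq_bigr => x _.
  transitivity (Ex p (fun H => 1 - (1 - q) * ((S, x) \in H)%:R)).
    by apply: eq_Ex => H; rewrite /F; case: (_ \in H); rewrite ?mulr1 ?mulr0 ?subr0 ?subKr.
  by rewrite ExB Ex_cst ExZ Ex_mem1 mulrC.
- by move=> x _ H; rewrite /F !inE eqxx andbT.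
move=> x y _ _ xy; rewrite -setI_eq0; apply/set0Pn => -[z].
by rewrite !inE => /andP[/eqP -> /eqP[]] /eqP; rewrite (negbTE xy).
Qed.

End OpenDirections.

(** Here l bounds the number of directions no longer available. Given the open directions N, each
    child contributes at most Phi plus an error c (l + |N| + 1)/d. Averaging Phi^|N| gives (1 - p (1
    - Phi))^|W|, close to exp(- alpha (1 - Phi)), and the errors involve only the bounded moments of
    |N| up to order two. *)
Lemma laplace_explore (alpha s : R) h : 0 < alpha -> 0 <= s <= 1 ->
  exists2 c, 0 <= c & forall d (S W : {set 'I_d}) l, alpha <= d%:R ->
    [disjoint S & W] -> (d <= #|W| + l)%N ->
    Ex (alpha / d%:R) (fun H => s ^+ #|explore h S W H|) <=
      1 - iter h (psi alpha) (1 - s) + c * l.+1%:R / d%:R.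
Proof.
move=> a0 s01; have /andP[s0 s1] := s01; elim: h => [|h [c c0 IH]].
  exists 0 => // d S W l ad dSW dl.
  under eq_Ex do rewrite /= cards1 expr1.
  by rewrite Ex_cst opprB addrCA subrr addr0 mul0r mul0r addr0 lexx.
exists (alpha + c * (2 * alpha + alpha ^+ 2)).
  by rewrite addr_ge0 ?mulr_ge0 ?addr_ge0 ?sqr_ge0 ?mulr_ge0 // ltW.
move=> d S W l ad dSW dl; set p := alpha / d%:R.
have dR : 0 < d%:R :> R by lra.
have p0 : 0 <= p by rewrite divr_ge0 // ltW.
have p1 : p <= 1 by rewrite /p ler_pdivrMr // mul1r.
have p01 : 0 <= p <= 1 by rewrite p0.
pose Phi := 1 - iter h (psi alpha) (1 - s).
have /andP[r0 r1] : 0 <= iter h (psi alpha) (1 - s) <= 1.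
  by apply: iter_psi_itv; [exact: ltW|lra].
have Phi01 : 0 <= Phi <= 1 by rewrite /Phi; lra.
have /andP[Phi0 Phi1] := Phi01.
pose N H := open_dirs S W H.
have NW H : N H \subset W by apply/fintype.subsetP => x; rewrite inE => /andP[].
(* H1 fixes the edges at S, hence N; everything above S comes from H2. *)
have step H1 : Ex p (fun H2 => s ^+ #|explore h.+1 S W (mix [set ed | ed.1 == S] H1 H2)|) <=
    Phi ^+ #|N H1| + #|N H1|%:R * (c * (l + #|N H1|).+1%:R / d%:R).
  have -> : Ex p (fun H2 => s ^+ #|explore h.+1 S W (mix [set ed | ed.1 == S] H1 H2)|) =
      Ex p (fun H2 => s ^+ #|explore_from h S (N H1) W H2|).
    apply: eq_Ex => H2; rewrite /=.
    have -> : open_dirs S W (mix [set ed | ed.1 == S] H1 H2) = N H1.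
      by apply/setP => x; rewrite [LHS]inE [RHS]inE in_mix inE /= eqxx.
    rewrite -/(explore_from h S (N H1) W _) (@explore_from_agree _ h S (N H1) W _ H2) // =>
      A x cA.
    rewrite in_mix inE /= ifN //; apply/eqP => AS; move: cA.
    by rewrite AS ltnn.
  rewrite Ex_laplace_explore_from // cardE; apply: prod_le_expr_in => //.
    by rewrite !mulr_ge0 ?invr_ge0 // ltW.
  move=> x; rewrite mem_enum => xN; split.
    apply/andP; split; first by apply: Ex_ge0 => // H; rewrite exprn_ge0.
    rewrite -[leRHS](Ex_cst ({set 'I_d} * 'I_d)%type p); apply: le_Ex => // H.
    exact: exprn_ile1.
  rewrite -cardE; apply: IH => //; first exact: disjoint_setU1D.
  rewrite cardsD (setIidPr (NW H1)).
  by rewrite [(l + _)%N]addnC addnA subnK // subset_leq_card.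
rewrite (Ex_mix p [set ed | ed.1 == S]).
apply: le_trans (le_Ex p01 step) _.
have pW : p * #|W|%:R <= alpha.
  rewrite /p mulrAC ler_pdivrMr // ler_wpM2l ?(ltW a0) // ler_nat.
  exact: card_le_d.
have pW0 : 0 <= p * #|W|%:R by rewrite mulr_ge0.
have cd0 : 0 <= c / d%:R by rewrite divr_ge0 // ltW.
have -> : Ex p (fun H1 => Phi ^+ #|N H1| + #|N H1|%:R * (c * (l + #|N H1|).+1%:R / d%:R)) =
  (1 - p * (1 - Phi)) ^+ #|W| + c / d%:R * (l.+1%:R * (p * #|W|%:R) +
     Ex p (fun H => #|N H|%:R ^+ 2)).
  rewrite ExD Ex_expr_card_open_dirs; congr (_ + _).
  rewrite -(Ex_card_open_dirs p S W) -ExZ -ExD -ExZ; apply: eq_Ex => H.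
  by rewrite -addSn natrD; ring.
have h1 := Ex_sqr_card_open_dirs S W p01; rewrite -/N in h1.
have h2 : Ex p (fun H => #|N H|%:R ^+ 2) <= alpha + alpha ^+ 2.
  by apply: le_trans h1 _; apply: lerD => //; rewrite lerXn2r ?nnegrE // ltW.
have l1 : 1 <= l.+1%:R :> R by rewrite ler1n.
have h3 : l.+1%:R * (p * #|W|%:R) + Ex p (fun H =>
  #|N H|%:R ^+ 2) <= (2 * alpha + alpha ^+ 2) * l.+1%:R.
  have h31 : l.+1%:R * (p * #|W|%:R) <= l.+1%:R * alpha by rewrite ler_wpM2l.
  have h32 : alpha + alpha ^+ 2 <= (alpha + alpha ^+ 2) * l.+1%:R.
    by rewrite ler_peMr // addr_ge0 ?sqr_ge0 // ltW.
  by lra.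
have h4 := ler_wpM2l cd0 h3.
have h5 : (1 - p * (1 - Phi)) ^+ #|W| <= expR (- (p * #|W|%:R * (1 - Phi))).
  apply: (@le_trans _ _ (expR (- (p * (1 - Phi))) ^+ #|W|)).
    rewrite lerXn2r ?nnegrE ?expR_ge0 ?expR_ge1Dx //.
    by have := mulr_ile1 p0 _ p1 (_ : 1 - Phi <= 1); lra.
  rewrite -expRM_natl le_eqVlt; apply/orP; left; apply/eqP; congr expR; ring.
(* The at most l missing directions lower the exponent by at most alpha l / d. *)
have ld : alpha * (1 - Phi) <= p * #|W|%:R * (1 - Phi) + alpha * l%:R / d%:R.
  have dl' : d%:R <= #|W|%:R + l%:R :> R by rewrite -natrD ler_nat.
  have h0 : alpha <= p * #|W|%:R + alpha * l%:R / d%:R.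
    have -> : p * #|W|%:R + alpha * l%:R / d%:R = alpha * ((#|W|%:R + l%:R) / d%:R).
      by rewrite /p; field; lra.
    by rewrite -[leLHS]mulr1 ler_wpM2l ?(ltW a0) // ler_pdivlMr // mul1r.
  have k0 : 0 <= alpha * l%:R / d%:R by rewrite !mulr_ge0 ?invr_ge0 // ltW.
  have hh : alpha * (1 - Phi) <= (p * #|W|%:R + alpha * l%:R / d%:R) * (1 - Phi).
    by rewrite ler_wpM2r //; lra.
  by nra.
have h6 : expR (- (p * #|W|%:R * (1 - Phi))) - alpha * l%:R / d%:R <=
  expR (- (alpha * (1 - Phi))).
  apply: le_trans (expRN_lip _ _) _.
  - by rewrite mulr_ge0 //; lra.
  - by rewrite !mulr_ge0 ?invr_ge0 // ltW.
  by rewrite ler_expR lerN2.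
have -> : 1 - iter h.+1 (psi alpha) (1 - s) = expR (- (alpha * (1 - Phi))).
  by rewrite /Phi /= {1}/psi !subKr.
have h7 : alpha * l%:R / d%:R <= alpha * l.+1%:R / d%:R.
  by rewrite ler_pM2r ?invr_gt0 // ler_pM2l // ler_nat.
have -> : (alpha + c * (2 * alpha + alpha ^+ 2)) * l.+1%:R / d%:R =
  alpha * l.+1%:R / d%:R + c / d%:R * ((2 * alpha + alpha ^+ 2) * l.+1%:R) by ring.
lra.
Qed.

End ExplorationLaplace.

(** * Supplying many vertices on a fixed level *)

Section Supply.
Variable d : nat.
Local Notation V := {set 'I_d}.
Local Notation T := (V * 'I_d)%type.
Implicit Types (S W A : V) (H : {set T}) (r h : nat).

(** The values r = 0 and r = 1 matter: giving up one step of the path replaces survival from the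
    empty set by survival from one of many vertices of level 1. *)
Definition reachset r h W H : {set V} :=
  [set a : V | [&& a \subset W, #|a| == h & [exists S : V, [exists s : (h - r).-tuple 'I_d,
     [&& #|S| == r, upath H S s & endp S s == a]]]]].

Lemma reachsetP r h W H (a : V) :
  reflect [/\ a \subset W, #|a| = h &
     exists S s, [/\ #|S| = r, size s = (h - r)%N, upath H S s & endp S s = a]]
    (a \in reachset r h W H).
Proof.
rewrite inE; apply: (iffP and3P) => -[aW /eqP ah].
  move=> /existsP[S /existsP[s /and3P[/eqP Sr Hs /eqP es]]].
  by split=> //; exists S, s; rewrite size_tuple.
case=> S [s [/eqP Sr /eqP sh Hs /eqP es]]; split=> //.
by apply/existsP; exists S; apply/existsP; exists (Tuple sh); apply/and3P.
Qed.

Lemma explore_reachset h W H : explore h set0 W H \subset reachset 0 h W H.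
Proof.
have dW : [disjoint (set0 : V) & W] by rewrite -setI_eq0 set0I.
apply/fintype.subsetP => a /(exploreP dW)[]; rewrite set0U => aW [s [sh Hs es]].
apply/reachsetP; split => //.
  by rewrite -es (card_endp Hs) cards0 sh.
by exists set0, s; rewrite cards0 subn0.
Qed.

Lemma explore_from_reachset h (C : V) W H : C \subset W ->
  explore_from h set0 C W H \subset reachset 1 h.+1 W H.
Proof.
move=> CW; have dW : [disjoint (set0 : V) & W] by rewrite -setI_eq0 set0I.
apply/fintype.subsetP => a /bigcupP[x xC].
move=> /(exploreP (disjoint_setU1D dW xC))[]; rewrite setU0 => aW [s [sh Hs es]].
apply/reachsetP; split.
- apply: subset_trans aW _; rewrite subUset sub1set (fintype.subsetP CW) //=.
  exact: subsetDl.
- by rewrite -es (card_endp Hs) cards1 sh.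
by exists [set x], s; rewrite cards1 subn1.
Qed.

End Supply.

Section SupplyProbability.
Variable R : realType.

(** Markov's inequality for s^f, with B at least s^(-K). *)
Lemma Ex_count_ge (T : finType) (p s B : R) (f : {set T} -> nat) K :
  0 <= p <= 1 -> 0 <= s <= 1 -> 0 <= B -> 1 <= B * s ^+ K ->
  1 - B * Ex p (fun H => s ^+ f H) <= Ex p (fun H => (K <= f H)%:R).
Proof.
move=> p01 /andP[s0 s1] B0 BK; rewrite -[X in X - _](Ex_cst T p) -ExZ -ExB.
apply: le_Ex => // H; have sf : 0 <= s ^+ f H by rewrite exprn_ge0.
have [Kf|fK] := leqP K (f H) => /=.
  by rewrite lerBlDr lerDl mulr_ge0.
rewrite subr_le0; apply: le_trans BK _; apply: ler_wpM2l => //.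
by rewrite ler_wiXn2l // ltnW.
Qed.

Lemma bernoulli_ge (r : R) K : 0 <= r <= 1 -> 1 - K%:R * r <= (1 - r) ^+ K.
Proof.
move=> /andP[r0 r1]; elim: K => [|K IH]; first by rewrite mul0r subr0 expr0 lexx.
rewrite exprS; apply: le_trans (ler_wpM2l _ IH); last by lra.
have := mulr_ge0 (ler0n R K) (sqr_ge0 r); rewrite -natr1; nra.
Qed.

(** s must be close to 1 for two reasons: s^K is nearly 1, and 1 - s lies where the iteration of
    [psi] increases to zeta. *)
Lemma laplace_parameter (alpha eps : R) K : 1 < alpha -> 0 < eps ->
  exists s : R, [/\ 0 <= s <= 1, 0 < 1 - s <= (alpha - 1) / alpha & 1 <= (1 + eps) * s ^+ K].
Proof.
move=> a1 e0; pose r := Num.min ((alpha - 1) / alpha) (eps / ((1 + eps) * K.+1%:R)).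
have a0 : 0 < alpha by lra.
have K0 : 0 < K.+1%:R :> R by rewrite ltr0n.
have d0 : 0 < (1 + eps) * K.+1%:R by rewrite mulr_gt0 //; lra.
have r0 : 0 < r by rewrite lt_min !divr_gt0 //; lra.
have ra : r <= (alpha - 1) / alpha by rewrite ge_min lexx.
have r1 : r <= 1 by apply: le_trans ra _; rewrite ler_pdivrMr //; lra.
have re : r * ((1 + eps) * K.+1%:R) <= eps by rewrite -ler_pdivlMr // ge_min lexx orbT.
exists (1 - r); rewrite subKr r0 ra; split => //; first lra.
have r01 : 0 <= r <= 1 by rewrite r1 ltW.
have e1 : 0 <= 1 + eps by lra.
have := ler_wpM2l e1 (bernoulli_ge K r01).
apply: le_trans; rewrite -natr1 in re.
by have := mulr_ge0 e1 (ltW r0); lra.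
Qed.

Lemma exists_small (c eps : R) : 0 < eps ->
  exists D : nat, forall d, (D <= d)%N -> c / d%:R <= eps /\ c <= d%:R * eps.
Proof.
move=> e0; exists (Num.bound (`|c| / eps)).+1 => d Dd.
have h : `|c| / eps < d%:R.
  apply: lt_le_trans (archi_boundP _) _; first by rewrite divr_ge0 // ltW.
  by rewrite ler_nat ltnW.
have d0 : 0 < d%:R :> R by rewrite ltr0n; case: d Dd {h}.
move: h; rewrite ltr_pdivrMr // => h.
have cd : c <= d%:R * eps by apply: le_trans (ler_norm c) _; exact: ltW.
by rewrite ler_pdivrMr // mulrC.
Qed.

Lemma iter_psi_ge (alpha r eps : R) : 1 < alpha -> 0 < r <= (alpha - 1) / alpha -> 0 < eps ->
  exists h0, forall h, (h0 <= h)%N -> zeta alpha - eps <= iter h (psi alpha) r.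
Proof.
move=> a1 ra e0; have /cvgrPdist_le/(_ _ e0)[h0 _ h0P] := iter_psi_cvg a1 ra.
by exists h0 => h hh; have := h0P h hh; rewrite /= ler_norml => /andP[]; lra.
Qed.

Lemma supply0 (alpha eps : R) K : 1 < alpha -> 0 < eps <= 1 ->
  exists h0, forall h, (h0 <= h)%N -> forall l, exists D, forall d, (D <= d)%N ->
  forall W : {set 'I_d}, (d <= #|W| + l)%N ->
  zeta alpha - 5 * eps <= Ex (alpha / d%:R) (fun H => (K <= #|reachset 0 h W H|)%N%:R).
Proof.
move=> a1 /andP[e0 e1]; have a0 : 0 < alpha by lra.
have [/andP[z0 z1] _] := (zetaP a1).1.
have [s [s01 sa sK]] := laplace_parameter K a1 e0.
have [h0 h0P] := iter_psi_ge a1 sa e0.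
exists h0 => h hh l; have [c c0 cP] := laplace_explore h a0 s01.
have [D1 D1P] := exists_small (c * l.+1%:R) e0.
have [D2 D2P] := exists_small alpha (ltr01 : 0 < 1 :> R).
exists (maxn D1 D2) => d; rewrite geq_max => /andP[/D1P[d1 _] /D2P[_ d2]] W dW.
rewrite mulr1 in d2; have dR : 0 < d%:R :> R by lra.
have p01 : 0 <= alpha / d%:R <= 1.
  by rewrite divr_ge0 ?(ltW a0) //= ler_pdivrMr // mul1r.
have dsj : [disjoint (set0 : {set 'I_d}) & W] by rewrite -setI_eq0 set0I.
apply: (@le_trans _ _ (Ex (alpha / d%:R) (fun H => (K <= #|explore h set0 W H|)%N%:R)));
  last first.
  apply: le_Ex => // H; rewrite ler_nat.
  case: (leqP K #|explore h set0 W H|) => // Kh.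
  by rewrite (leq_trans Kh) // subset_leq_card // explore_reachset.
have e1' : 0 <= 1 + eps by lra.
apply: le_trans (Ex_count_ge _ p01 s01 e1' sK).
have hE := cP d set0 W l d2 dsj dW; have h1 := h0P h hh.
have {}hE : Ex (alpha / d%:R) (fun H =>
  s ^+ #|explore h set0 W H|) <= 1 - zeta alpha + 2 * eps by lra.
(* (1 + eps)(1 - zeta + 2 eps) <= 1 - zeta + 5 eps, as eps <= 1. *)
have := ler_wpM2l e1' hE; nra.
Qed.

(** M seeds of level 1 explore disjoint subcubes, so their Laplace transforms multiply to at most
    t^M with t < 1 fixed. M does not depend on d, hence neither does the number l + M of lost
    directions. *)
Lemma supply1 (alpha eps : R) K : 1 < alpha -> 0 < eps <= 1 ->
  exists h0, forall h, (h0 <= h)%N -> forall l, exists D, forall d, (D <= d)%N ->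
  forall W : {set 'I_d}, (d <= #|W| + l)%N ->
  1 - eps <= Ex (alpha / d%:R) (fun H => (K <= #|reachset 1 h W H|)%N%:R).
Proof.
move=> a1 /andP[e0 e1]; have a0 : 0 < alpha by lra.
have [/andP[z0 z1] _] := (zetaP a1).1.
have [s [s01 sa sK]] := laplace_parameter K a1 (ltr01 : 0 < 1 :> R).
have z4 : 0 < zeta alpha / 4 by rewrite divr_gt0.
have [h0 h0P] := iter_psi_ge a1 sa z4.
(* One seed has Laplace transform at most 1 - (zeta - zeta/4) + zeta/4. *)
pose t := 1 - zeta alpha / 2.
have t01 : 0 <= t < 1 by rewrite /t; lra.
have [M MP] : exists M, 2 * t ^+ M <= eps.
  have e2 : 0 < eps / 2 by lra.
  have tn : (t ^+ n @[n --> \oo] --> (0 : R))%classic.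
    by apply: cvg_expr; rewrite ger0_norm; case/andP: t01.
  have /cvgrPdist_le/(_ _ e2)[M _ MP] := tn.
  exists M; have := MP M (leqnn M); rewrite /= sub0r normrN ger0_norm; first lra.
  by rewrite exprn_ge0 //; case/andP: t01.
exists h0.+1 => -[//|h] hh l; have [c c0 cP] := laplace_explore h a0 s01.
have [D1 D1P] := exists_small (c * (l + M).+1%:R) z4.
have [D2 D2P] := exists_small alpha (ltr01 : 0 < 1 :> R).
exists (maxn (maxn D1 D2) (l + M)%N) => d; rewrite !geq_max.
move=> /andP[/andP[/D1P[d1 _] /D2P[_ d2]] d3] W dW.
rewrite mulr1 in d2; have dR : 0 < d%:R :> R by lra.
have p01 : 0 <= alpha / d%:R <= 1.
  by rewrite divr_ge0 ?(ltW a0) //= ler_pdivrMr // mul1r.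
have MW : (M <= #|W|)%N by rewrite -(leq_add2l l) (leq_trans d3) // addnC.
have /card_geqP[C0 [uC sC CW']] := MW.
pose C := [set x in C0].
have CW : C \subset W by apply/fintype.subsetP => x; rewrite inE => /CW'.
have cC : #|C| = M by rewrite cardsE (card_uniqP uC).
have dsj : [disjoint (set0 : {set 'I_d}) & W] by rewrite -setI_eq0 set0I.
apply: (@le_trans _ _ (Ex (alpha / d%:R) (fun H =>
  (K <= #|explore_from h set0 C W H|)%N%:R))); last first.
  apply: le_Ex => // H; rewrite ler_nat.
  case: (leqP K #|explore_from h set0 C W H|) => // Kh.
  by rewrite (leq_trans Kh) // subset_leq_card // explore_from_reachset.
have e1' : 0 <= 1 + 1 :> R by lra.
apply: le_trans (Ex_count_ge _ p01 s01 e1' sK).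
rewrite Ex_laplace_explore_from //.
suff : \prod_(x <- enum C) Ex (alpha / d%:R)
    (fun H => s ^+ #|explore h (x |: set0) (W :\: C) H|) <= t ^+ M by lra.
rewrite -cC big_enum /= -prodr_const; apply: ler_prod => x xC; apply/andP; split.
  by apply: Ex_ge0 => // H; rewrite exprn_ge0 //; case/andP: s01.
have hd : (d <= #|W :\: C| + (l + M))%N by rewrite cardsDS // cC [(l + M)%N]addnC addnA subnK.
have := cP d _ _ _ d2 (disjoint_setU1D dsj xC) hd; have := h0P h hh.
by rewrite /t; lra.
Qed.

End SupplyProbability.

(** * Joining the bottom and the top *)

Section Assembly.
Variable d : nat.
Local Notation V := {set 'I_d}.
Local Notation T := (V * 'I_d)%type.
Implicit Types (S W : V) (H : {set T}) (r h : nat).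

Definition glue h H1 H2 H3 : {set T} :=
  mix (levels d 0 h) H1 (mix (levels d (d - h) d.+1) H2 H3).

Lemma glueE h H1 H2 H3 (A : V) (x : 'I_d) : (h + h <= d)%N ->
  ((A, x) \in glue h H1 H2 H3) =
  if (#|A| < h)%N then (A, x) \in H1
  else if (#|A| < d - h)%N then (A, x) \in H3 else (A, x) \in H2.
Proof.
move=> hd; rewrite /glue !in_mix !inE /= ltnS card_le_d andbT.
by case: ltnP => // _; case: leqP.
Qed.

Lemma ell_glue r r' h H1 H2 H3 W W' (a b : V) s :
  (r <= h)%N -> (r' <= h)%N -> (h + h <= d)%N ->
  a \in reachset r h W H1 -> b \in reachset r' h W' (@dual_edge d @^-1: H2) ->
  size s = (d - h - h)%N -> upath H3 a s -> endp a s = ~: b ->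
  (d - r - r' <= ell (cube_graph (glue h H1 H2 H3)))%N.
Proof.
move=> rh rh' hd /reachsetP[_ ah [S [s1 [Sr s1h Hs1 es1]]]].
move=> /reachsetP[_ bh [S' [s3 [Sr' s3h Hs3 es3]]]] sh Hs es.
have [Hr er] := upath_dual Hs3; rewrite es3 in Hr er.
apply/leq_ellP; exists S, (s1 ++ s ++ rev s3); split.
  by rewrite !size_cat size_rev s1h sh s3h; lia.
have cb : #|~: b| = (d - h)%N by rewrite cardsCs setCK card_ord bh.
rewrite !upath_cat es1 es; apply/and3P; split.
- rewrite (@upath_agree _ _ H1) // => A x; rewrite Sr s1h => /andP[_ Ah].
  by rewrite glueE // ifT //; lia.
- rewrite (@upath_agree _ _ H3) // => A x; rewrite ah sh => /andP[h1 h2].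
  have h3 : (#|A| < d - h)%N by move: h2;
    rewrite subnKC // leq_subRL // (leq_trans _ hd) // leq_addl.
  by rewrite glueE // ltnNge h1 h3.
rewrite (@upath_agree _ _ H2) // => A x; rewrite cb size_rev s3h => /andP[h1 h2].
have h3 : (h <= #|A|)%N by apply: leq_trans h1; rewrite leq_subRL // (leq_trans _ hd) // leq_addl.
by rewrite glueE // ltnNge h3 ltnNge h1.
Qed.

Lemma subset_enum K (X : {set V}) : (K <= #|X|)%N ->
  exists2 a : 'I_K -> V, injective a & forall i, a i \in X.
Proof.
case/card_geqP => s [us ss sX]; exists (fun i => nth set0 s i).
  move=> i j /eqP; rewrite nth_uniq ?ss // => /eqP; exact: val_inj.
by move=> i; apply: sX; rewrite mem_nth // ss.
Qed.

Lemma card_bigcup_le K h (a : 'I_K -> V) : (forall i, #|a i| = h) ->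
  (#|\bigcup_i a i| <= K * h)%N.
Proof.
move=> ah; apply: leq_trans (_ : \sum_(i < K) #|a i| <= _)%N; last first.
  by rewrite (eq_bigr _ (fun i _ => ah i)) sum_nat_const card_ord.
elim/big_ind2: _ => // [|m A n B Am Bn]; first by rewrite cards0.
by apply: leq_trans (leq_of_leqif (leq_card_setU A B)) _; exact: leq_add.
Qed.

End Assembly.

Section Core.
Variable R : realType.

(** Limiting probability that many vertices are reached when paths may start at level r. *)
Definition start_prob (alpha : R) r : R := if r is 0%N then zeta alpha else 1.

Lemma supply (alpha eps : R) K : 1 < alpha -> 0 < eps <= 1 ->
  exists h0, forall h, (h0 <= h)%N -> forall l, exists D, forall d, (D <= d)%N ->
  forall (W : {set 'I_d}) r, (d <= #|W| + l)%N -> (r <= 1)%N ->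
  start_prob alpha r - 5 * eps <=
    Ex (alpha / d%:R) (fun H => (K <= #|reachset r h W H|)%N%:R).
Proof.
move=> a1 e01; have [h0 h0P] := supply0 K a1 e01; have [h1 h1P] := supply1 K a1 e01.
exists (maxn h0 h1) => h; rewrite geq_max => /andP[/h0P hh0 /h1P hh1] l.
have [D0 D0P] := hh0 l; have [D1 D1P] := hh1 l.
exists (maxn D0 D1) => d; rewrite geq_max => /andP[dD0 dD1] W [|[|//]] dW _.
  exact: D0P.
by apply: le_trans (D1P d dD1 W dW); move/andP: e01 => [e0 _]; rewrite /start_prob; lra.
Qed.

(* H1, H2 and H3 supply the edges of the bottom, the top and the middle levels. The top is
   explored only in directions outside U, the union of the chosen bottom vertices, so that
   every bottom vertex lies below every top vertex. *)
Lemma connect_top (alpha eps : R) : expR 1 < alpha -> 0 < eps <= 1 ->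
  exists K h0, forall h, (h0 <= h)%N -> exists D, forall d, (D <= d)%N ->
  forall r r' (H1 : {set {set 'I_d} * 'I_d}), (r <= 1)%N -> (r' <= 1)%N ->
  (K <= #|reachset r h [set: 'I_d] H1|)%N ->
  start_prob alpha r' - 7 * eps <=
  Ex (alpha / d%:R) (fun H2 => Ex (alpha / d%:R) (fun H3 =>
    (d - r - r' <= ell (cube_graph (glue h H1 H2 H3)))%N%:R)).
Proof.
move=> ae e01; have /andP[e0 e1] := e01.
have E1 : 1 < expR 1 :> R by have := @expR_gt1Dx R 1 (oner_neq0 R); lra.
have a1 : 1 < alpha by lra.
have a0 : 0 < alpha by lra.
(* eta puts (1 + eta) e halfway between e and alpha, so kappa = (1 + eta) e / alpha is below 1. The
   gap rho - kappa compensates for the middle part having length d - 2h instead of d. *)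
pose eta := (alpha / expR 1 - 1) / 2.
have eta0 : 0 < eta.
  by rewrite divr_gt0 // subr_gt0 ltr_pdivlMr ?mul1r // expR_gt0.
have etaE : (1 + eta) * expR 1 = (alpha + expR 1) / 2 by rewrite /eta; field; lra.
pose kappa := (alpha + expR 1) / 2 / alpha.
have kappa1 : kappa < 1 by rewrite ltr_pdivrMr //; lra.
have kappa0 : 0 < kappa by rewrite !divr_gt0 //; lra.
pose rho := (1 + kappa) / 2.
have rho01 : 0 <= rho < 1 by rewrite /rho; lra.
have [C C0 CP] := middle_connect eta0 rho01.
have [K0 K0P] := exists_small C e0.
pose K := K0.+1; have [Kle _] := K0P K (leqnSn K0).
have [h0 h0P] := supply K a1 e01.
exists K, h0.+1 => h hh.
have h1 : (0 < h)%N by exact: leq_ltn_trans hh.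
have [D1 D1P] := h0P h (ltnW hh) (K * h)%N.
have [D2 D2P] := exists_small alpha (ltr01 : 0 < 1 :> R).
have rk : 0 < rho - kappa by rewrite /rho; lra.
have [D3 D3P] := exists_small (2 * h%:R * rho) rk.
have [D4 D4P] := exists_small C e0.
exists (maxn (maxn D1 D2) (maxn D3 (D4 + h + h).+1)) => d; rewrite !geq_max.
move=> /andP[/andP[dD1 /D2P[_ d2]] /andP[/D3P[_ d3] d4]] r r' H1 r1 r'1 HK.
rewrite mulr1 in d2; have dR : 0 < d%:R :> R by lra.
have h2d : (h + h < d)%N by apply: leq_trans d4; rewrite ltnS -addnA leq_addl.
have rh : (r <= h)%N by exact: leq_trans r1 h1.
have r'h : (r' <= h)%N by exact: leq_trans r'1 h1.
pose n := (d - h - h)%N.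
have nE : (h + n + h = d)%N by rewrite addnAC /n -subnDA subnKC // ltnW.
have n0 : (0 < n)%N by rewrite /n -subnDA subn_gt0.
have nR : n%:R = d%:R - 2 * h%:R :> R by rewrite -[in RHS]nE !natrD; ring.
have Dn : (D4 <= n)%N.
  by rewrite /n -subnDA (leq_subRL _ (ltnW h2d)) addnC addnA; exact: ltnW d4.
have [Cn _] := D4P n Dn.
pose p := alpha / d%:R; rewrite -/p.
have p0 : 0 < p by rewrite divr_gt0.
have p1 : p <= 1 by rewrite /p ler_pdivrMr // mul1r.
have p01 : 0 <= p <= 1 by rewrite ltW.
have hn : (1 + eta) * ((1 - p) / p) * expR 1 <= rho * n%:R.
  rewrite mulrAC etaE; apply: (@le_trans _ _ (kappa * d%:R)); last first.
    by rewrite nR; lra.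
  have -> : kappa * d%:R = (alpha + expR 1) / 2 * (1 / p) by rewrite /kappa /p; field; lra.
  rewrite ler_wpM2l //; first lra.
  by rewrite ler_pM2r ?invr_gt0 //; lra.
have [a ainj aP] := subset_enum HK.
have acard i : #|a i| = h by have /reachsetP[] := aP i.
pose U := \bigcup_i a i.
have UK : (#|U| <= K * h)%N by exact: card_bigcup_le.
have dW : (d <= #|~: U| + K * h)%N.
  by rewrite -[X in (X <= _)%N]card_ord -(cardsC U) addnC leq_add2l.
pose top (H : {set {set 'I_d} * 'I_d}) : R := (K <= #|reachset r' h (~: U) H|)%N%:R.
have Etop := D1P d dD1 (~: U) r' dW r'1; rewrite -/p -/(top _) in Etop.
have Etop1 : Ex p top <= 1.
  rewrite -[leRHS](Ex_cst ({set 'I_d} * 'I_d)%type p); apply: le_Ex => // H.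
  by rewrite /top; case: (_ <= _)%N.
(* The loss 7 eps is 5 eps for the supply at the top and 2 eps for the connection, whose probability
   is at least 1/(1 + 2 eps). *)
apply: (@le_trans _ _ (Ex p (fun H2 => (1 - 2 * eps) * top (@dual_edge d @^-1: H2)))).
  rewrite ExZ (Ex_involution p top (@dual_edgeK d)).
  have h5 : start_prob alpha r' - 5 * eps <= Ex p top by exact: Etop.
  have e2 : 0 <= 2 * eps by lra.
  have := ler_wpM2l e2 Etop1; lra.
apply: le_Ex => // H2; rewrite /top;
  have [HK2|_] := boolP (K <= #|reachset r' h (~: U) (@dual_edge d @^-1: H2)|)%N; last first.
  by rewrite mulr0n mulr0; apply: Ex_ge0 => // H3.
rewrite mulr1n mulr1; have [b binj bP] := subset_enum HK2.
have bcard i : #|b i| = h by have /reachsetP[] := bP i.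
have bU i : b i \subset ~: U by have /reachsetP[] := bP i.
pose f H3 := \sum_i paths_in R H3 n (a i) (~: b i).
have q1 : 1 <= Ex p (fun H3 => (0 < f H3)%R%:R) * (1 + C / K%:R + C / n%:R).
  apply: (CP d p n K h a (fun i => ~: b i)) => //.
  - by rewrite p0.
  - by move=> i j /(congr1 (@finset.setC _)); rewrite !setCK => /binj.
  - move=> i; rewrite -setCS setCK; apply: subset_trans (bU i) _.
    by rewrite setCS (bigcup_sup i).
  - move=> i; rewrite cardsCs setCK card_ord bcard.
    by rewrite -[in LHS]nE addnK.
set q := Ex p _ in q1.
apply: (@le_trans _ _ q).
  have q0 : 0 <= q by apply: Ex_ge0 => // H.
  have hq : q * (1 + C / K%:R + C / n%:R) <= q * (1 + 2 * eps).
    by apply: ler_wpM2l => //; lra.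
  have hq2 : 1 <= q * (1 + 2 * eps) by exact: le_trans hq.
  have [q2|q2] := leP q 1; first by nra.
  by lra.
apply: le_Ex => // H3; rewrite ler_nat; case: (ltP 0 (f H3)) => // f0.
rewrite lt0b.
have [i fi] : exists i, 0 < paths_in R H3 n (a i) (~: b i).
  apply/existsP; apply: contraTT f0 => /existsPn no; rewrite -leNgt.
  by apply: sumr_le0 => i _; rewrite leNgt; exact: no.
have [s [sn Hs es]] := paths_in_gt0 fi.
by apply: (ell_glue rh r'h (ltnW h2d) (aP i) (bP i) sn Hs es).
Qed.

End Core.

(** * Long paths force survival at the ends *)

Section AliveEll.
Variable d : nat.
Local Notation V := {set 'I_d}.
Local Notation T := (V * 'I_d)%type.
Implicit Types (S : V) (H : {set T}) (h : nat).

Lemma alive_prefix h H s : (h <= size s)%N -> upath H (set0 : V) s -> alive h set0 H.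
Proof.
move=> hs; rewrite -{1}(cat_take_drop h s) upath_cat => /andP[Hs _].
by apply/aliveP; exists (take h s) => //; rewrite size_takel.
Qed.

Lemma alive_dual_suffix h H S s : (h <= size s)%N -> upath H S s ->
  endp S s = [set: 'I_d] -> alive h set0 (@dual_edge d @^-1: H).
Proof.
move=> hs Hs es; have HE : H = @dual_edge d @^-1: (@dual_edge d @^-1: H).
  by apply/setP => ed; rewrite !inE dual_edgeK.
rewrite HE in Hs; have [Hr _] := upath_dual Hs; rewrite es setCT in Hr.
by apply: alive_prefix Hr; rewrite size_rev.
Qed.

Lemma ell_full_alive h H : (h <= d)%N -> (d <= ell (cube_graph H))%N ->
  alive h set0 H && alive h set0 (@dual_edge d @^-1: H).
Proof.
move=> hd /leq_ellP[S [s [sd Hs]]].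
have S0 : S = set0.
  apply/eqP; rewrite -cards_eq0; have := upath_size_le Hs.
  by rewrite sd; set n := #|S|; clear; lia.
rewrite S0 in Hs; apply/andP; split; first by apply: alive_prefix Hs; rewrite sd.
apply: (alive_dual_suffix _ Hs); first by rewrite sd.
by apply/eqP; rewrite eqEcard subsetT cardsT card_ord (card_endp Hs) sd leq_addl.
Qed.

(** A path of length at least d - 1 that does not start at the empty set must end at the full
    set. *)
Lemma ell_near_full_alive h H : (h < d)%N -> (d - 1 <= ell (cube_graph H))%N ->
  alive h set0 H || alive h set0 (@dual_edge d @^-1: H).
Proof.
move=> hd /leq_ellP[S [s [sd Hs]]].
have hs : (h <= size s)%N by rewrite sd leq_subRL ?add1n // (leq_trans _ hd).
have [S0|/set0Pn[x xS]] := eqVneq S set0.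
  by apply/orP; left; apply: alive_prefix hs _; rewrite -S0.
apply/orP; right; apply: (alive_dual_suffix hs Hs).
apply/eqP; rewrite eqEcard subsetT cardsT card_ord (card_endp Hs) sd.
have S1 : (0 < #|S|)%N by apply/card_gt0P; exists x.
have d1 : (0 < d)%N by exact: leq_ltn_trans hd.
by move: S1 d1; set n := #|S|; clear; lia.
Qed.

(** The two events read edges of the lowest h and of the highest h levels, which are disjoint as 2h
    <= d. *)
Lemma Ex_alive_indep (R : realType) (p : R) h : (h + h <= d)%N ->
  Ex p (fun H => (alive h set0 H)%:R * (alive h set0 (@dual_edge d @^-1: H))%:R) =
  Ex p (fun H => (alive h set0 H)%:R) ^+ 2.
Proof.
move=> hd; rewrite (@Ex_indep _ _ p (levels d 0 h)).
- rewrite expr2; congr (_ * _).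
  by rewrite -[RHS](Ex_involution p _ (@dual_edgeK d)).
- move=> H; congr (_ %:R); congr nat_of_bool; apply: alive_agree => A x _.
  by rewrite cards0 add0n !inE /= => -> _; rewrite andbT.
move=> H; congr (_ %:R); congr nat_of_bool; apply: alive_agree => A x _.
rewrite cards0 add0n => Ah xA; rewrite !inE /dual_edge /= (negbTE xA).
rewrite -leqNgt cardsCs setCK card_ord cardsU1 xA add1n.
have -> : (h <= d - #|A|.+1)%N.
  by rewrite leq_subRL ?(leq_trans _ hd) // ?leq_add2r // (leq_trans Ah) // leq_addr.
by rewrite andbT.
Qed.

End AliveEll.

(** 12 = 5 + 7, the losses for the bottom supply and for the conditional connection. As Z' - 7 eps
    may be negative, X <= 1 is used besides the lower bound on X. *)
Lemma conditional_prob_le (R : realFieldType) (eps X Z Z' : R) : 0 <= eps ->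
  X <= 1 -> Z - 5 * eps <= X -> 0 <= Z' <= 1 ->
  Z * Z' - 12 * eps <= (Z' - 7 * eps) * X.
Proof.
move=> e0 X1 ZX /andP[z0 z1].
have : 0 <= Z' * (X - (Z - 5 * eps)) by rewrite mulr_ge0 // subr_ge0.
have : 0 <= eps * (1 - X) by rewrite mulr_ge0 // subr_ge0.
have : 0 <= eps * (1 - Z') by rewrite mulr_ge0 // subr_ge0.
by nra.
Qed.

Section Limits.
Variables (R : realType) (alpha : R).
Hypothesis alpha_gt_e : expR 1 < alpha.

Let E1 : 1 < expR 1 :> R.
Proof. by have := @expR_gt1Dx R 1 (oner_neq0 R); lra. Qed.
Let a1 : 1 < alpha. Proof. exact: lt_trans E1 alpha_gt_e. Qed.
Let a0 : 0 < alpha. Proof. by have := a1; lra. Qed.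

Local Notation z := (zeta alpha).

Let z0 : 0 < z. Proof. by have [/andP[]] := (zetaP a1).1. Qed.
Let z1 : z < 1. Proof. by have [/andP[]] := (zetaP a1).1. Qed.

Definition ell_prob (d j : nat) : R :=
  Ex (alpha / d%:R) (fun H : {set {set 'I_d} * 'I_d} =>
    (d - j <= ell (cube_graph H))%N%:R).

Lemma edge_prob_itv d : alpha <= d%:R -> 0 <= alpha / d%:R <= 1.
Proof.
move=> ad; have dR : 0 < d%:R :> R by exact: lt_le_trans a0 ad.
by rewrite divr_ge0 ?(ltW a0) //= ler_pdivrMr // mul1r.
Qed.

Lemma ell_prob_lower (eps : R) : 0 < eps <= 1 -> exists D, forall d, (D <= d)%N ->
  [/\ z ^+ 2 - 12 * eps <= ell_prob d 0,
      2 * z - z ^+ 2 - 12 * eps <= ell_prob d 1 &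
      1 - 12 * eps <= ell_prob d 2].
Proof.
move=> e01; have /andP[e0 e1] := e01.
have [K [h1 h1P]] := connect_top alpha_gt_e e01.
have [h2 h2P] := supply K a1 e01.
pose h := maxn h1 h2.
have [D1 D1P] := h1P h (leq_maxl _ _).
have [D2 D2P] := h2P h (leq_maxr _ _) 0%N.
have [D3 D3P] := exists_small alpha (ltr01 : 0 < 1 :> R).
exists (maxn (maxn D1 D2) D3) => d; rewrite !geq_max => /andP[/andP[dD1 dD2] /D3P[_ ad]].
rewrite mulr1 in ad; have p01 := edge_prob_itv ad.
pose p := alpha / d%:R; rewrite -/p in p01.
pose s r (H : {set {set 'I_d} * 'I_d}) := (K <= #|reachset r h [set: 'I_d] H|)%N.
have Es r : (r <= 1)%N -> start_prob alpha r - 5 * eps <= Ex p (fun H => (s r H)%:R).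
  by move=> r1; apply: D2P => //; rewrite cardsT card_ord addn0.
have Es1 r : Ex p (fun H => (s r H)%:R) <= 1.
  rewrite -[leRHS](Ex_cst ({set 'I_d} * 'I_d)%type p); apply: le_Ex => // H.
  by case: (s r H).
have nested j : ell_prob d j = Ex p (fun H1 : {set {set 'I_d} * 'I_d} => Ex p (fun H2 =>
  Ex p (fun H3 =>
    (d - j <= ell (cube_graph (glue h H1 H2 H3)))%N%:R))).
  rewrite /ell_prob -/p [LHS](Ex_mix p (levels d 0 h)).
  apply: eq_Ex => H1.
  by rewrite [LHS](Ex_mix p (levels d (d - h) d.+1)).
have nested0 (H1 : {set {set 'I_d} * 'I_d}) j : 0 <= Ex p (fun H2 => Ex p (fun H3 =>
    (d - j <= ell (cube_graph (glue h H1 H2 H3)))%N%:R)).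
  by do 2 (apply: Ex_ge0 => // ?).
have inner r r' (H1 : {set {set 'I_d} * 'I_d}) : (r <= 1)%N -> (r' <= 1)%N -> s r H1 ->
    start_prob alpha r' - 7 * eps <= Ex p (fun H2 => Ex p (fun H3 =>
    (d - (r + r') <= ell (cube_graph (glue h H1 H2 H3)))%N%:R)).
  by move=> r1 r'1 sr; have := D1P d dD1 r r' H1 r1 r'1 sr; rewrite -/p subnDA.
have zr r : (r <= 1)%N -> 0 <= start_prob alpha r <= 1.
  by case: r => [|r] _ /=; rewrite ?lexx ?ler01 //; apply/andP; split; apply: ltW.
have low r r' : (r <= 1)%N -> (r' <= 1)%N ->
    start_prob alpha r * start_prob alpha r' - 12 * eps <= ell_prob d (r + r').
  move=> r1 r'1.
  apply: (@le_trans _ _ (Ex p (fun H1 => (start_prob alpha r' - 7 * eps) * (s r H1)%:R))).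
    by rewrite ExZ; apply: conditional_prob_le; rewrite ?zr ?Es ?Es1 // ltW.
  rewrite nested; apply: le_Ex => // H1.
  case sr : (s r H1); last by rewrite mulr0 nested0.
  by rewrite mulr1; exact: inner.
split; [by rewrite expr2; exact: (low 0%N 0%N)| |by rewrite -[X in X - _]mulr1;
  exact: (low 1%N 1%N)].
(* If the empty set supplies the bottom, the top may lose a step and succeeds with probability near
   1; if only level 1 does, the top must be reached in full, with probability near z. The mean is
   about z + (1 - z) z. *)
apply: (@le_trans _ _ (Ex p (fun H1 => z * (s 1%N H1)%:R + (1 - z) * (s 0%N H1)%:R - 7 * eps))).
  rewrite ExB ExD Ex_cst !ExZ.
  have h0' := Es 0%N isT; have h1' := Es 1%N isT; rewrite /= in h0' h1'.
  have g1 := ler_wpM2l (ltW z0) h1'.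
  have g0 : (1 - z) * (z - 5 * eps) <= (1 - z) * Ex p (fun H => (s 0%N H)%:R).
    by rewrite ler_wpM2l // subr_ge0 ltW.
  by lra.
rewrite nested; apply: le_Ex => // H1.
case sH0 : (s 0%N H1).
  have := inner 0%N 1%N H1 isT isT sH0; rewrite /= add0n mulr1n mulr1.
  by apply: le_trans; case: (s 1%N H1); rewrite /= ?mulr1n ?mulr0n ?mulr1 ?mulr0; have := z0; lra.
rewrite mulr0n mulr0 addr0; case sH1 : (s 1%N H1).
  by have := inner 1%N 0%N H1 isT isT sH1; rewrite /= mulr1n mulr1.
rewrite mulr0n mulr0 sub0r; apply: le_trans (nested0 H1 1%N).
by rewrite oppr_le0 mulr_ge0 // ltW.
Qed.

(** Length d needs survival at the bottom and at the top, length d - 1 at one of them at least.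
    These are independent with the same probability f, so the bounds are f^2 and 2f - f^2. *)
Lemma ell_prob_upper (eps : R) : 0 < eps <= 1 -> exists D, forall d, (D <= d)%N ->
  ell_prob d 0 <= z ^+ 2 + 12 * eps /\ ell_prob d 1 <= 2 * z - z ^+ 2 + 12 * eps.
Proof.
move=> e01; have /andP[e0 e1] := e01.
have /cvgrPdist_le/(_ _ e0)[h _ hP] := iter_psi1_cvg a1.
have {}hP : iter h (psi alpha) 1 <= z + eps.
  by have := hP h (leqnn h); rewrite /= ler_norml => /andP[]; lra.
have [c c0 cP] := alive_ub h a0.
have [D1 D1P] := exists_small c e0.
have [D2 D2P] := exists_small (2 * alpha) (ltr01 : 0 < 1 :> R).
exists (maxn (maxn D1 D2) (h + h).+1) => d; rewrite !geq_max.
move=> /andP[/andP[/D1P[d1 _] /D2P[_ d2]] d3]; rewrite mulr1 in d2.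
have ad : alpha <= d%:R by have := a0; lra.
have p01 := edge_prob_itv ad; pose p := alpha / d%:R; rewrite -/p in p01.
have hd : (h < d)%N by apply: leq_ltn_trans d3; rewrite leq_addr.
pose A (H : {set {set 'I_d} * 'I_d}) := alive h set0 H.
pose f := Ex p (fun H => (A H)%:R).
have f0 : 0 <= f by apply: Ex_ge0 => // H.
have f1 : f <= 1.
  rewrite -[leRHS](Ex_cst ({set 'I_d} * 'I_d)%type p); apply: le_Ex => // H.
  by case: (A H).
have fz : f <= z + 2 * eps by have := cP d set0 d2; rewrite -/p -/A -/f; lra.
have ff := Ex_alive_indep p (ltnW d3).
have fd : Ex p (fun H => (A (@dual_edge d @^-1: H))%:R) = f.
  exact: (Ex_involution p (fun H => (A H)%:R) (@dual_edgeK d)).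
split.
  apply: (@le_trans _ _ (f ^+ 2)); last first.
    have : 0 <= (z + 2 * eps - f) * (z + f + 2 * eps) by rewrite mulr_ge0 //; have := z0; lra.
    have : 0 <= eps * (1 - z) by apply: mulr_ge0; have := z1; lra.
    have : 0 <= eps * (1 - eps) by apply: mulr_ge0; lra.
    by nra.
  rewrite -ff; apply: le_Ex => // H; rewrite -natrM mulnb ler_nat subn0.
  by have [/(ell_full_alive (ltnW hd)) ->|//] := boolP (d <= ell (cube_graph H))%N.
apply: (@le_trans _ _ (f + f - f ^+ 2)); last first.
  have : 0 <= (z + 2 * eps - f) * (2 - f) by rewrite mulr_ge0 //; lra.
  have : 0 <= (z - f) ^+ 2 by exact: sqr_ge0.
  have := z1; have := z0; nra.
rewrite -ff -{2}fd -ExD -ExB; apply: le_Ex => // H; rewrite -natrM mulnb.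
rewrite -/(A H) -/(A _).
have [/(ell_near_full_alive hd)|_] := boolP (d - 1 <= ell (cube_graph H))%N.
  by rewrite -/(A H) -/(A _); case: (A H); case: (A _) => //= _; lra.
by case: (A H); case: (A _) => /=; lra.
Qed.

Lemma ell_prob_cvg : [/\ (ell_prob d 0 @[d --> \oo] --> z ^+ 2)%classic,
  (ell_prob d 1 @[d --> \oo] --> 2 * z - z ^+ 2)%classic &
  (ell_prob d 2 @[d --> \oo] --> (1 : R))%classic].
Proof.
have main (eps : R) : 0 < eps -> exists D, forall d, (D <= d)%N ->
    [/\ `|z ^+ 2 - ell_prob d 0| <= eps, `|2 * z - z ^+ 2 - ell_prob d 1| <= eps &
        `|1 - ell_prob d 2| <= eps].
  move=> e0; pose e' := Num.min 1 (eps / 12).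
  have e'01 : 0 < e' <= 1 by rewrite lt_min ltr01 divr_gt0 //= ge_min lexx.
  have e'12 : 12 * e' <= eps.
    have : e' <= eps / 12 by rewrite ge_min lexx orbT.
    by lra.
  have [D1 D1P] := ell_prob_lower e'01; have [D2 D2P] := ell_prob_upper e'01.
  have [D3 D3P] := exists_small alpha (ltr01 : 0 < 1 :> R).
  exists (maxn (maxn D1 D2) D3) => d;
    rewrite !geq_max => /andP[/andP[/D1P[l0 l1 l2] /D2P[u0 u1]] /D3P[_ ad]].
  rewrite mulr1 in ad; have u2 : ell_prob d 2 <= 1.
    rewrite -[leRHS](Ex_cst ({set 'I_d} * 'I_d)%type (alpha / d%:R)).
    by apply: le_Ex => [|H]; [exact: edge_prob_itv|case: (_ <= _)%N].
  by split; rewrite ler_norml; apply/andP; split; lra.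
by split; apply/cvgrPdist_le => eps /main[D DP]; exists D => // d /= /DP[].
Qed.

End Limits.

(** * The first moment below the threshold *)

Section FirstMoment.
Variable R : realType.

Lemma sum_expr_card d (x : R) : \sum_(S : {set 'I_d}) x ^+ #|S| = (1 + x) ^+ d.
Proof.
transitivity (\prod_(i < d) (x + 1)); last by rewrite prodr_const card_ord addrC.
rewrite bigA_distr; apply: eq_bigr => S _; rewrite -prodr_const big_mkcond.
exact: eq_bigr.
Qed.

(* The left-hand side counts pairs S subset b with |b| = |S| + k, for which
   x^(d-k) = x^|S| x^|~: b|. *)
Lemma sum_psum1_le d (x : R) k : 0 < x -> (k <= d)%N ->
  x ^+ (d - k) * \sum_(S : {set 'I_d}) \sum_(b : {set 'I_d}) psum (fun=> 1) k S b
  <= k`!%:R * (1 + x) ^+ (2 * d).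
Proof.
move=> x0 kd; rewrite mul2n -addnn exprD -{1}sum_expr_card mulr_suml !mulr_sumr.
apply: ler_sum => S _; rewrite -sum_expr_card !mulr_sumr.
rewrite [leRHS](reindex_inj (@finset.setC_inj _)) /=; apply: ler_sum => b _.
rewrite psum1E; case: ifP => [/andP[Sb /eqP cb]|_]; last first.
  by rewrite mulr0 !mulr_ge0 // exprn_ge0 // ltW.
rewrite -exprD mulrC ler_pM2l ?ltr0n ?fact_gt0 // le_eqVlt; apply/orP; left; apply/eqP.
have cbC : #|~: b| = (d - #|b|)%N by rewrite cardsCs setCK card_ord.
congr (_ ^+ _); have := card_le_d b; rewrite cbC cb; set n := #|S|; clear; lia.
Qed.

Lemma paths_in_ge1 d (H : {set {set 'I_d} * 'I_d}) S s : upath H S s ->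
  1 <= paths_in R H (size s) S (endp S s).
Proof.
rewrite /paths_in; elim: s S => [|x s IH] S /=; first by rewrite eqxx.
move=> /and3P[xS xH /IH h]; rewrite (bigD1 x) //= {1}/mem_wt xH mul1r.
apply: le_trans h _; rewrite lerDl; apply: sumr_ge0 => y _.
by rewrite mulr_ge0 ?ler0n // psum_ge0 // => ed; exact: ler0n.
Qed.

Lemma first_moment d (p x : R) k : 0 <= p <= 1 -> 0 < x -> (k <= d)%N ->
  x ^+ (d - k) * Ex p (fun H : {set {set 'I_d} * 'I_d} => (k <= ell (cube_graph H))%N%:R)
  <= p ^+ k * k`!%:R * (1 + x) ^+ (2 * d).
Proof.
move=> p01 x0 kd; have /andP[p0 p1] := p01.
rewrite -mulrA; apply: le_trans _ (ler_wpM2l (exprn_ge0 _ p0) (sum_psum1_le x0 kd)).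
rewrite [leRHS]mulrCA; apply: ler_wpM2l; first by rewrite exprn_ge0 // ltW.
rewrite mulr_sumr; under eq_bigr do rewrite mulr_sumr.
under eq_bigr do under eq_bigr do rewrite -Ex_paths_in.
under eq_bigr do rewrite -Ex_sum.
rewrite -Ex_sum; apply: le_Ex => // H.
have pos S b : 0 <= paths_in R H k S b by apply: psum_ge0 => ed; exact: ler0n.
have pos2 S : 0 <= \sum_b paths_in R H k S b by apply: sumr_ge0 => b _.
case: leq_ellP => [[S [s [sk Hs]]]|_]; last by apply: sumr_ge0 => S _.
apply: le_trans (paths_in_ge1 Hs) _; rewrite sk (bigD1 S) //= (bigD1 (endp S s)) //=.
by rewrite -addrA lerDl addr_ge0 ?sumr_ge0.
Qed.

(** With u the square root of t, d u^d is at most the sum of u^i over i < d, hence bounded, and the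
    other factor u^d tends to 0. *)
Lemma mulrn_expr_cvg0 (c t : R) : 0 <= t < 1 ->
  ((fun d : nat => c * d%:R * t ^+ d) @ \oo --> (0 : R))%classic.
Proof.
move=> /andP[t0 t1]; pose u := Num.sqrt t.
have u0 : 0 <= u by exact: sqrtr_ge0.
have uu : u ^+ 2 = t by rewrite sqr_sqrtr.
have u1 : u < 1 by rewrite -[ltRHS]sqrtr1 ltr_sqrt // ltr01.
have bound (d : nat) : `|c * d%:R * t ^+ d| <= `|c| * (1 - u)^-1 * u ^+ d.
  rewrite -uu -exprM mul2n -addnn exprD !normrM normr_nat.
  have un : 0 <= u ^+ d by rewrite exprn_ge0.
  rewrite !(ger0_norm un) -!mulrA; apply: ler_wpM2l => //.
  rewrite mulrA; apply: ler_wpM2r => //.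
  apply: le_trans (sum_expr_le d _); last by rewrite u0.
  rewrite -[X in X%:R]card_ord mulr_natl -sumr_const; apply: ler_sum => i _.
  by rewrite ler_wiXn2l ?(ltW u1) // ltnW.
have lim : ((fun d : nat => `|c| * (1 - u)^-1 * u ^+ d) @ \oo --> (0 : R))%classic.
  rewrite -[X in (_ --> X)%classic](mulr0 (`|c| * (1 - u)^-1)).
  by apply: cvgMr; apply: cvg_expr; rewrite ger0_norm.
apply/cvgrPdist_le => eps e0; have /cvgrPdist_le/(_ _ e0)[D _ DP] := lim.
exists D => // d /= Dd; have := DP d Dd; rewrite /= !sub0r !normrN.
by apply: le_trans; apply: le_trans (bound d) _; exact: ler_norm.
Qed.

Lemma subcritical (alpha : R) : 0 < alpha -> alpha < expR 1 ->
  exists2 N, (0 < N)%N & ((fun d => Ex (alpha / d%:R)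
     (fun H : {set {set 'I_d} * 'I_d} => (d - d %/ N <= ell (cube_graph H))%N%:R))
     @ \oo --> (0 : R))%classic.
Proof.
move=> a0 ae; pose beta := alpha / expR 1.
have E0 : 0 < expR 1 :> R by exact: expR_gt0.
have b0 : 0 < beta by rewrite divr_gt0.
have b1 : beta < 1 by rewrite ltr_pdivrMr // mul1r.
(* Then (1 + x)^2 <= 2 - beta, and theta <= (2 - beta) beta < 1. *)
pose x := (1 - beta) / 3.
have x0 : 0 < x by rewrite /x; lra.
pose theta := (1 + x) ^+ 2 * beta.
have th0 : 0 <= theta by rewrite mulr_ge0 ?sqr_ge0 // ltW.
have th1 : theta < 1.
  have h : theta <= (2 - beta) * beta by rewrite /theta /x ler_pM2r //; nra.
  by apply: le_lt_trans h _; nra.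
(* theta^d splits into two factors t^d: one gives the decay, the other pays for (x beta)^(-r), the
   price of the r missing steps. N is chosen so that t^N pays for one such step, and N r <= d. *)
pose t := Num.sqrt theta.
have t0 : 0 <= t by exact: sqrtr_ge0.
have tt : t ^+ 2 = theta by rewrite sqr_sqrtr.
have t1 : t < 1 by rewrite -[ltRHS]sqrtr1 ltr_sqrt // ltr01.
pose M := (x * beta)^-1.
have M0 : 0 < M by rewrite invr_gt0 mulr_gt0.
have [N tN] : exists N, t ^+ N * M <= 1.
  have tn : (t ^+ n @[n --> \oo] --> (0 : R))%classic.
    by apply: cvg_expr; rewrite ger0_norm.
  have Mi : 0 < M^-1 by rewrite invr_gt0.
  have /cvgrPdist_le/(_ _ Mi)[N _ NP] := tn.
  exists N; have := NP N (leqnn N); rewrite /= sub0r normrN ger0_norm ?exprn_ge0 //.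
  by move=> h; rewrite -ler_pdivlMr // mul1r.
exists N.+1 => //.
have lim := mulrn_expr_cvg0 (expR 1) (_ : 0 <= t < 1).
have {}lim := lim (introT andP (conj t0 t1)).
apply/cvgrPdist_le => eps e0; have /cvgrPdist_le/(_ _ e0)[D1 _ D1P] := lim.
have [D2 D2P] := exists_small alpha (ltr01 : 0 < 1 :> R).
exists (maxn D1 D2) => // d /=; rewrite geq_max => /andP[dD1 /D2P[_ ad]].
rewrite mulr1 in ad; have dR : 0 < d%:R :> R by exact: lt_le_trans a0 ad.
have p01 : 0 <= alpha / d%:R <= 1.
  by rewrite divr_ge0 ?(ltW a0) //= ler_pdivrMr // mul1r.
pose r := (d %/ N.+1)%N; pose k := (d - r)%N.
have rd : (r <= d)%N by exact: leq_div.
have kd : (k <= d)%N by exact: leq_subr.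
have dk : (d - k)%N = r by rewrite /k subKn.
have := first_moment p01 x0 kd; rewrite dk.
set P := Ex _ _ => hP.
have P0 : 0 <= P by apply: Ex_ge0 => // H; exact: ler0n.
rewrite sub0r normrN ger0_norm //.
have := D1P d dD1; rewrite /= sub0r normrN ger0_norm; last first.
  by rewrite !mulr_ge0 ?exprn_ge0 // ltW.
apply: le_trans.
set p := alpha / d%:R in hP *; set e1 := expR 1 in E0 hP *.
have d1 : 1 <= d%:R :> R by rewrite ler1n -(ltr0n R).
have e1ge : 1 <= e1 by rewrite /e1 -expR0 ler_expR.
have pk : p ^+ k * k`!%:R <= e1 * d%:R * beta ^+ k.
  have [k0|k0] := posnP k.
    by rewrite k0 !expr0 mul1r mulr1 (_ : 0`! = 1%N) // mulr_ege1.
  have -> : p = beta * e1 / d%:R by rewrite /p /beta divfK // gt_eqF.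
  rewrite expr_div_n exprMn mulrAC ler_pdivrMr ?exprn_gt0 //.
  have h1 := fact_ub R k0; rewrite -/e1 in h1.
  have h2 : e1 * k%:R * k%:R ^+ k <= e1 * d%:R * d%:R ^+ k.
    apply: ler_pM; rewrite ?mulr_ge0 ?exprn_ge0 ?(ltW E0) //.
      by rewrite ler_pM2l // ler_nat.
    by rewrite lerXn2r ?nnegrE // ler_nat.
  have -> : e1 * d%:R * beta ^+ k * d%:R ^+ k = beta ^+ k * (e1 * d%:R * d%:R ^+ k) by ring.
  by rewrite -[leLHS]mulrA ler_pM2l ?exprn_gt0 // (le_trans h1).
have h1 : (x * beta) ^+ r * P <= e1 * d%:R * (t ^+ d * t ^+ d).
  have -> : t ^+ d * t ^+ d = beta ^+ r * (beta ^+ k * (1 + x) ^+ (2 * d)).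
    rewrite -exprD addnn -mul2n exprM tt /theta exprMn -exprM mulrC mulrA -exprD.
    by rewrite /k subnKC.
  have -> : e1 * d%:R * (beta ^+ r * (beta ^+ k * (1 + x) ^+ (2 * d))) =
    beta ^+ r * (e1 * d%:R * beta ^+ k * (1 + x) ^+ (2 * d)) by ring.
  rewrite exprMn mulrAC mulrC ler_pM2l ?exprn_gt0 //.
  apply: le_trans hP _; apply: ler_wpM2r => //.
  by rewrite exprn_ge0 // addr_ge0 // ltW.
have h2 : M ^+ r * t ^+ d <= 1.
  have Nr : (N * r <= d)%N.
    by apply: leq_trans (leq_trunc_div d N.+1); rewrite mulnC leq_mul2l leqnSn orbT.
  apply: (@le_trans _ _ (M ^+ r * t ^+ (N * r))).
    by rewrite ler_wpM2l ?exprn_ge0 ?(ltW M0) // ler_wiXn2l // ltW.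
  by rewrite exprM -exprMn mulrC exprn_ile1 // mulr_ge0 ?exprn_ge0 // ltW.
have -> : P = M ^+ r * ((x * beta) ^+ r * P).
  by rewrite mulrA -exprMn /M mulVf ?expr1n ?mul1r // gt_eqF // mulr_gt0.
apply: le_trans (ler_wpM2l _ h1) _; first by rewrite exprn_ge0 // ltW.
have -> : M ^+ r * (e1 * d%:R * (t ^+ d * t ^+ d)) = (e1 * d%:R * t ^+ d) * (M ^+ r * t ^+ d)
  by ring.
by rewrite ler_piMr // !mulr_ge0 ?exprn_ge0 ?(ltW E0).
Qed.

End FirstMoment.

Local Open Scope classical_set_scope.
Local Open Scope ring_scope.

Lemma relative_error (R : realType) (f g : nat -> R) (L : R) : L != 0 ->
  g @ \oo --> L -> (\forall d \near \oo, f d = g d) ->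
  exists eps : nat -> R, eps @ \oo --> (0 : R) /\
    \forall d \near \oo, f d = (1 + eps d) * L.
Proof.
move=> L0 gL fg; exists (fun d => g d / L - 1); split.
  rewrite -[X in _ --> X](subrr 1); apply: cvgB; last exact: cvg_cst.
  by rewrite -[X in _ --> X](mulfV L0); apply: cvgMl.
by apply: filterS fg => d ->; rewrite addrC subrK divfK.
Qed.

Theorem theorem1p1 (R : realType) (alpha : R) (alpha_gt0 : 0 < alpha) :
  (alpha < expR 1 ->
    exists delta : R, 0 <= delta < 1 /\
      (fun d : nat => Pr_cube (alpha / d%:R)
         (fun H : {set {set cube d}} => (ell H)%:R <= delta * d%:R))
        @ \oo --> (1 : R))
  /\
  (expR 1 < alpha ->
    [/\ (fun d : nat => Pr_cube (alpha / d%:R)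
           (fun H : {set {set cube d}} => (d - 2 <= ell H)%N))
          @ \oo --> (1 : R),
        exists eps : nat -> R, eps @ \oo --> (0 : R) /\
          \forall d \near \oo,
            Pr_cube (alpha / d%:R)
              (fun H : {set {set cube d}} => ell H == d)
            = (1 + eps d) * zeta alpha ^+ 2
      & exists eps : nat -> R, eps @ \oo --> (0 : R) /\
          \forall d \near \oo,
            Pr_cube (alpha / d%:R)
              (fun H : {set {set cube d}} => ell H == (d - 1)%N)
            = (1 + eps d) * (2 * zeta alpha * (1 - zeta alpha))]).
Proof.
split=> [alpha_lt|alpha_gt].
  have [N N0 lim] := subcritical alpha_gt0 alpha_lt.
  have NR : (0 : R) < N%:R by rewrite ltr0n.
  have N1 : (1 : R) <= N%:R by rewrite ler1n.
  (* A path longer than delta d has length at least d minus the integer part of d/N. *)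
  exists (1 - N%:R^-1); split.
    by rewrite subr_ge0 invf_le1 // N1 /= gtrBl invr_gt0.
  apply/cvgrPdist_le => eps e0; have /cvgrPdist_le/(_ _ e0)[D1 _ D1P] := lim.
  have [D2 D2P] := exists_small alpha (ltr01 : 0 < 1 :> R).
  exists (maxn D1 D2) => // d /=; rewrite geq_max => /andP[dD1 /D2P[_ ad]].
  rewrite mulr1 in ad.
  have := D1P d dD1; rewrite /= sub0r normrN; set p := alpha / d%:R.
  have dR : 0 < d%:R :> R by exact: lt_le_trans ad.
  have p01 : 0 <= p <= 1.
    by rewrite divr_ge0 ?(ltW alpha_gt0) //= ler_pdivrMr // mul1r.
  rewrite Pr_cubeE; apply: le_trans.
  rewrite -[X in X - _](Ex_cst ({set 'I_d} * 'I_d)%type p) -ExB ger0_norm; last first.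
    by apply: Ex_ge0 => // H; rewrite subr_ge0 lern1 leq_b1.
  apply: le_trans (ler_norm _); apply: le_Ex => // H.
  have [_|ellH] := leqP (d - d %/ N) (ell (cube_graph H)).
    by rewrite gerBl ler0n.
  suff -> : (ell (cube_graph H))%:R <= (1 - N%:R^-1) * d%:R :> R by rewrite mulr1n subrr.
  have ld : (ell (cube_graph H) + (d %/ N).+1 <= d)%N.
    by move: ellH (leq_div d N); set q := (d %/ N)%N; clear; lia.
  have {}ld : (ell (cube_graph H))%:R + (d %/ N).+1%:R <= d%:R :> R by rewrite -natrD ler_nat.
  have dN : d%:R / N%:R < (d %/ N).+1%:R :> R.
    by rewrite ltr_pdivrMr // -natrM ltr_nat ltn_ceil.
  by rewrite mulrBl mul1r [N%:R^-1 * _]mulrC; lra.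
have [c0 c1 c2] := ell_prob_cvg alpha_gt.
have a1 : 1 < alpha.
  by apply: lt_trans alpha_gt; have := @expR_gt1Dx R 1 (oner_neq0 R); lra.
have [/andP[z0 z1] _] := (zetaP a1).1.
split.
- rewrite (_ : (fun d => _) = fun d => ell_prob alpha d 2) //.
  by apply/funext => d; rewrite Pr_cubeE.
- apply: relative_error c0 _; first by rewrite expf_neq0 // gt_eqF.
  apply: nearW => d; rewrite Pr_cubeE; apply: eq_Ex => H.
  by rewrite eqn_leq ell_le_d subn0.
(* Length exactly d - 1 is the difference of the two tail events, with limit 2z - z^2 - z^2. *)
apply: (@relative_error _ _ (fun d => ell_prob alpha d 1 - ell_prob alpha d 0)).
- by rewrite !mulf_neq0 ?gt_eqF // subr_gt0.
- rewrite (_ : 2 * _ * _ = 2 * zeta alpha - zeta alpha ^+ 2 - zeta alpha ^+ 2); last by ring.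
  exact: cvgB.
(* At d = 0 the truncated d - 1 equals d and the difference of tails would be wrong. *)
exists 1%N => // d /= d0; rewrite Pr_cubeE /ell_prob -ExB; apply: eq_Ex => H.
have := ell_le_d H; rewrite subn0; set m := ell _ => md.
have [dm|dm] := leqP d m.
  by rewrite gtn_eqF ?(leq_trans (leq_subr _ _) dm) ?subrr // ltn_subLR // add1n ltnS.
have -> : (m == d - 1)%N = (d - 1 <= m)%N by rewrite eqn_leq leq_subRL // add1n dm.
by rewrite mulr0n subr0.
Qed.
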